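(* Let $\gamma$ be a functorial satisfying (F1), (F2) and (F3). If a finite group $G=AB$ is the mutually permutable product of its subgroups $A$ and $B$, then $h_\gamma(G)\le\max\{h_\gamma(A^{\mathfrak{N}^*}),h_\gamma(B^{\mathfrak{N}^*})\}+2$. Moreover, if $\gamma$ also satisfies (F5), then $\max\{h_\gamma(A^{\mathfrak{N}^*}),h_\gamma(B^{\mathfrak{N}^*})\}\le h_\gamma(G)$.
   Context: All groups are finite. A functorial is a function $\theta$ assigning to each group $G$ a characteristic subgroup $\theta(G)$ such that $f(\theta(G))=\theta(f(G))$ for every isomorphism $f$. Conditions (for every group $G$): (F1) $f(\gamma(G))\subseteq\gamma(f(G))$ for every epimorphism $f:G\to G^*$; (F2) $\gamma(N)\subseteq\gamma(G)$ for every $N\trianglelefteq G$; (F3) $C_G(\gamma(G))\subseteq\gamma(G)$; (F5) $\gamma(G)\cap N\subseteq\gamma(N)$ for every $N\trianglelefteq G$. The $\gamma$-series is $\gamma_{(0)}(G)=1$ and $\gamma_{(i+1)}(G)$ the full preimage of $\gamma(G/\gamma_{(i)}(G))$; $h_\gamma(G)$ is the least $h$ with $\gamma_{(h)}(G)=G$. $\mathfrak{N}^*$ is the formation of quasinilpotent groups and $H^{\mathfrak{N}^*}$ is the smallest normal subgroup of $H$ with quasinilpotent quotient. $G=AB$ is a mutually permutable product if $A$ permutes with every subgroup of $B$ and $B$ permutes with every subgroup of $A$. *)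

(* Defs.v *)
From mathcomp Require Import all_boot all_fingroup all_solvable.
Set Implicit Arguments.
Unset Strict Implicit.
Unset Printing Implicit Defensive.
Local Open Scope group_scope.

Definition functorial (gamma : GFunctor.object_map) : Prop :=
  [/\ forall (gT : finGroupType) (G : {group gT}), group_set (gamma gT G),
      forall (gT : finGroupType) (G : {group gT}), gamma gT G \char G &
      forall (gT hT : finGroupType) (G : {group gT}) (f : {morphism G >-> hT}),
        'injm f -> f @* gamma gT G = gamma hT (f @* G)].

Definition cond_F1 (gamma : GFunctor.object_map) : Prop :=
  forall (gT hT : finGroupType) (G : {group gT}) (f : {morphism G >-> hT}),
    f @* gamma gT G \subset gamma hT (f @* G).

Definition cond_F2 (gamma : GFunctor.object_map) : Prop :=
  forall (gT : finGroupType) (N G : {group gT}),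
    N <| G -> gamma gT N \subset gamma gT G.

Definition cond_F3 (gamma : GFunctor.object_map) : Prop :=
  forall (gT : finGroupType) (G : {group gT}),
    'C_G(gamma gT G) \subset gamma gT G.

Definition cond_F5 (gamma : GFunctor.object_map) : Prop :=
  forall (gT : finGroupType) (N G : {group gT}),
    N <| G -> gamma gT G :&: N \subset gamma gT N.

Fixpoint gamma_series (gamma : GFunctor.object_map) (n : nat)
    : GFunctor.object_map :=
  match n with
  | 0 => fun gT (A : {set gT}) => [1 gT]
  | n'.+1 => GFunctor.modulo gamma (gamma_series gamma n')
  end.

(* h_gamma(G): least h with gamma_(h)(G) = G.  The search ranges over
   h <= #|G|; under (F3) the series strictly increases until it reaches G,
   so the least such h always lies in that range. *)
Definition h_gamma (gamma : GFunctor.object_map) (gT : finGroupType)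
    (G : {set gT}) : nat :=
  find (fun n => @gamma_series gamma n gT G == G) (iota 0 #|G|.+1).

Definition centsec (gT : finGroupType) (G U V : {set gT}) : {set gT} :=
  [set g in G | [~: U, <[g]>] \subset V].

(* Quasinilpotent (Doerk--Hawkes): every element of G induces an inner
   automorphism on every chief factor U/V of G, i.e. G = U * C_G(U/V). *)
Definition quasinilpotent (gT : finGroupType) (G : {group gT}) : bool :=
  [forall V : {group gT}, forall U : {group gT},
     chief_factor G V U ==> (G :==: U * centsec G U V)].

Definition qn_residual (gT : finGroupType) (H : {group gT}) : {set gT} :=
  \bigcap_(N : {group gT} | (N <| H) && quasinilpotent (H / N)%G) N.

Definition mutually_permutable (gT : finGroupType) (G A B : {group gT}) : Prop :=
  [/\ A * B = G,
      forall U : {group gT}, U \subset B -> A * U = U * A &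
      forall U : {group gT}, U \subset A -> B * U = U * B].

(* Main.v *)
Require Import Defs.
From mathcomp Require Import all_boot all_fingroup all_solvable.

(* For a mutually permutable product G = AB, the subgroups A' and A :&: B are
   subnormal in G, hence so are the quasinilpotent residuals A* <= A' and
   B* <= B'.  By (F1) and (F2) the gamma-series of a subnormal subgroup lies
   termwise in the one of G (and, with (F5), is its trace on the subgroup, which
   is the second inequality).  So with h the maximum on the right, the h-th term
   Z of the series of G contains A* and B*, and G / Z is a mutually permutable
   product of quasinilpotent groups.  Such a group H satisfies
   H' <= gamma(H): H' induces inner automorphisms on every chief factor of H, so
   H' = (gamma(H) :&: H') * K with K normal and acting nilpotently on gamma(H);
   by (F3), K is nilpotent, whence K <= gamma(H).  Two more steps thus reach
   G. *)

Set Implicit Arguments.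
Unset Strict Implicit.
Unset Printing Implicit Defensive.
Local Open Scope group_scope.

(** * Nilpotent actions and chief factors *)

(** Nothing makes A or B itself subnormal in G, so only subgroups of A', B' and A :&: B can be
    compared with G; abelian groups being quasinilpotent, the residuals do lie in A' and B'. For the
    subnormality of A', induction on |G| leaves the case where A supplements every minimal normal
    subgroup of G, and there A is forced to be abelian. Subnormality is then exploited through one
    principle: a subnormal subgroup acts nilpotently on every normal subgroup that it meets
    trivially, and a nilpotent action of a subnormal subgroup on a minimal normal subgroup is
    trivial. The constant 2 is attained: the symmetric group of degree 3 is the mutually permutable
    product of cyclic groups of orders 3 and 2, both residuals are trivial, and its height is 2 when
    gamma is the generalised Fitting subgroup. *)

Definition rcomm (gT : finGroupType) (U K : {set gT}) (n : nat) : {set gT} :=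
  iter n (fun X => [~: X, K]) U.

Lemma rcomm_group_set (gT : finGroupType) (U : {group gT}) (K : {set gT}) n :
  group_set (rcomm U K n).
Proof. by case: n => [|n]; apply: groupP. Qed.

Canonical rcomm_group (gT : finGroupType) (U : {group gT}) (K : {set gT}) n :=
  Group (rcomm_group_set U K n).

Lemma rcommS (gT : finGroupType) (U K : {set gT}) n :
  rcomm U K n.+1 = [~: rcomm U K n, K].
Proof. by []. Qed.

Lemma rcommD (gT : finGroupType) (U K : {set gT}) m n :
  rcomm U K (m + n) = rcomm (rcomm U K m) K n.
Proof. by rewrite addnC /rcomm iterD. Qed.

Lemma rcomm_sub (gT : finGroupType) (U V K L : {set gT}) n :
  U \subset V -> K \subset L -> rcomm U K n \subset rcomm V L n.
Proof. by move=> sUV sKL; elim: n => //= n IH; apply: commgSS. Qed.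

Lemma rcomm_sub_id (gT : finGroupType) (U K : {group gT}) n :
  K \subset 'N(U) -> rcomm U K n \subset U.
Proof.
move=> nUK; elim: n => //= n IH.
by apply: subset_trans (commSg _ IH) _; rewrite commg_subl.
Qed.

(** One commutation with [K] already moves [G] into the normal subgroup [L] that follows it in a
    chain down to [K]. *)
Lemma rcomm_subnormal (gT : finGroupType) (K G : {group gT}) :
  K <|<| G -> exists m, rcomm G K m \subset K.
Proof.
have [n] := ubnP #|G|; elim: n G => // n IH G ltGn /[dup] snKG.
case/subnormalEr=> [-> | [L [snKL nsLG ltLG]]]; first by exists 0%N.
have [|m sm] := IH L _ snKL.
  by apply: leq_trans (proper_card ltLG) _.
exists (1 + m); rewrite rcommD; apply: subset_trans sm.
apply: rcomm_sub => //=; apply: subset_trans (commgS _ (subnormal_sub snKL)) _.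
by rewrite commg_subr normal_norm.
Qed.

(** This turns subnormality into nilpotent action: [K] acts nilpotently on [U] as soon as it does so
    on [U :&: K]. *)
Lemma rcomm_subnormalI (gT : finGroupType) (U K G : {group gT}) :
  U <| G -> K <|<| G -> exists m, rcomm U K m \subset U :&: K.
Proof.
move=> /andP[sUG nUG] snKG; have [m sm] := rcomm_subnormal snKG.
exists m; rewrite subsetI rcomm_sub_id ?(subset_trans (subnormal_sub snKG)) //=.
exact: subset_trans (rcomm_sub _ sUG (subxx _)) sm.
Qed.

Lemma minnormalP (gT : finGroupType) (U G : {group gT}) :
  reflect [/\ U :!=: 1, G \subset 'N(U) &
    forall X : {group gT}, X :!=: 1 -> G \subset 'N(X) -> X \subset U -> X :=: U]
   (minnormal U G).
Proof.
apply: (iffP mingroupP) => [[/andP[ntU nUG] min] | [ntU nUG min]].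
  by split=> // X ntX nXG sXU; apply: min => //; rewrite ntX.
by split=> [|X /andP[ntX nXG] sXU]; [rewrite ntU | apply: min].
Qed.

Lemma minnormal_conj (gT : finGroupType) (U L : {group gT}) x :
  x \in 'N(L) -> minnormal U L -> minnormal (U :^ x) L.
Proof.
move=> nLx /minnormalP[ntU nUL min]; apply/minnormalP; split => /=.
- by rewrite -(conjs1g x) (inj_eq (@conjsg_inj _ x)).
- by rewrite -(normP nLx) normJ conjSg.
move=> X ntX nXL sXU /=.
have /= <- : X :^ x^-1 = U.
  apply: (min (X :^ x^-1)%G) => /=.
  - by rewrite -(conjs1g x^-1) (inj_eq (@conjsg_inj _ _)).
  - by rewrite -(normP (groupVr nLx)) normJ conjSg.
  - by rewrite sub_conjgV.
by rewrite conjsgKV.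
Qed.

Lemma minnormal_gen_class (gT : finGroupType) (U G X : {group gT}) :
  minnormal U G -> X :!=: 1 -> X \subset U -> <<class_support X G>> = U.
Proof.
move=> /minnormalP[ntU nUG min] ntX sXU.
apply: (min <<class_support X G>>%G) => /=.
- apply: subG1_contra ntX; apply: subset_trans (subset_gen _).
  exact: sub_class_support.
- by rewrite norms_gen // class_support_norm.
- rewrite gen_subG class_supportEr; apply/bigcupsP=> x Gx.
  by rewrite -(normsP nUG x Gx) conjSg.
Qed.

(* If K <|<| L <| G, then U is generated by the conjugates of a minimal normal
   subgroup of L, and K centralises each of these by induction. *)
Lemma subnormal_nilact_minnormal (gT : finGroupType) (U G K : {group gT}) m :
  minnormal U G -> K <|<| G -> rcomm U K m = 1 -> K \subset 'C(U).
Proof.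
have [n] := ubnP #|G|; elim: n G U => // n IH G U ltGn minU /[dup] snKG.
have /minnormalP[ntU nUG min] := minU.
case/subnormalEr=> [defK | [L [snKL nsLG ltLG]]] rU1.
  (* For [K = G], minimality makes [U, G] equal to 1 or [U]; in the second case every iterated
     commutator is [U], against [rU1]. *)
  rewrite defK in rU1 *.
  rewrite centsC; apply/commG1P; apply: contra_eq rU1 => ntUG.
  have eqUG : [~: U, G] = U.
    by apply: (min [~: U, G]%G) => //=; rewrite ?normsR ?normG ?commg_subl.
  suff -> : rcomm U G m = U by [].
  by elim: (m) => //= k ->.
have nUL := subset_trans (normal_sub nsLG) nUG.
have [X minX sXU] := minnormal_exists ntU nUL.
have [ntX nXL _] := minnormalP _ _ minX.
rewrite centsC -(minnormal_gen_class minU ntX sXU) gen_subG.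
rewrite class_supportEr; apply/bigcupsP=> x Gx.
have nLx : x \in 'N(L) by apply: subsetP Gx; apply: normal_norm.
have sXxU : X :^ x \subset U by rewrite -(normsP nUG x Gx) conjSg.
rewrite centsC; apply: (IH L (X :^ x)%G) => //.
- by apply: leq_trans (proper_card ltLG) _.
- exact: minnormal_conj.
by apply/trivgP; rewrite -rU1 rcomm_sub.
Qed.

(** Elements of [M] act on each chief factor of [G] as elements of that factor do; on an abelian
    factor, [M] acts trivially. The case [M = G] is quasinilpotence; products will need the derived
    subgroup as [M]. *)
Definition acts_inner (gT : finGroupType) (G M : {set gT}) : Prop :=
  forall N U : {group gT}, chief_factor G N U ->
    M \subset U * 'C_G(U / N | 'Q).

Lemma chief_factorP (gT : finGroupType) (G N U : {group gT}) :
  reflect [/\ N <| G, U <| G, N \proper U & forall X : {group gT},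
    X <| G -> N \subset X -> X \proper U -> X :=: N]
   (chief_factor G N U).
Proof.
apply: (iffP andP) => [[/maxgroupP[/andP[ltNU nNG] max] nsUG] | [nsN nsU ltNU max]].
  have sUG := normal_sub nsUG; split=> //.
    by rewrite /normal nNG (subset_trans (proper_sub ltNU)).
  by move=> X /andP[sXG nXG] sNX ltXU; apply: max => //; rewrite ltXU.
split=> //; apply/maxgroupP; split; first by rewrite ltNU normal_norm.
move=> X /andP[ltXU nXG] sNX; apply: max => //.
by rewrite /normal nXG (subset_trans (proper_sub ltXU)) ?normal_sub.
Qed.

Lemma mem_centsecQ (gT : finGroupType) (G N U : {group gT}) g :
  N <| G -> U \subset G -> g \in G ->
  (g \in 'C_G(U / N | 'Q)) = ([~: U, <[g]>] \subset N).
Proof.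
move=> /andP[sNG nNG] sUG Gg; rewrite inE Gg /= -cycle_subG sub_astabQR.
- by rewrite commGC.
- by rewrite cycle_subG (subsetP nNG).
- exact: subset_trans sUG nNG.
Qed.

Lemma centsecE (gT : finGroupType) (G N U : {group gT}) :
  N <| G -> U \subset G -> centsec G U N = 'C_G(U / N | 'Q).
Proof.
move=> nsNG sUG; apply/setP=> g; rewrite inE.
have [Gg|notGg] := boolP (g \in G); first by rewrite mem_centsecQ.
by rewrite inE (negbTE notGg).
Qed.

Lemma sub_centsecQ (gT : finGroupType) (G N U X : {group gT}) :
  N <| G -> U \subset G -> X \subset G ->
  (X \subset 'C_G(U / N | 'Q)) = ([~: U, X] \subset N).
Proof.
move=> /andP[sNG nNG] sUG sXG; rewrite subsetI sXG /= sub_astabQR.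
- by rewrite commGC.
- exact: subset_trans sXG nNG.
- exact: subset_trans sUG nNG.
Qed.

Lemma centsecQ_comm (gT : finGroupType) (G N U : {group gT}) :
  N <| G -> U \subset G -> [~: U, 'C_G(U / N | 'Q)] \subset N.
Proof. by move=> nsN sUG; rewrite -(@sub_centsecQ _ G) ?subsetIl. Qed.

Lemma centsecQ_normal (gT : finGroupType) (G N U : {group gT}) :
  N <| G -> U <| G -> 'C_G(U / N | 'Q) <| G.
Proof.
move=> /andP[_ nNG] /andP[_ nUG]; rewrite /normal subsetIl.
rewrite normsI ?normG // astabQ.
apply: subset_trans (morphpre_norm _ _).
rewrite -sub_quotient_pre // norms_cent //; exact: quotient_norms.
Qed.

Lemma chief_factor_exists (gT : finGroupType) (G N T : {group gT}) :
  N <| G -> T <| G -> N \proper T ->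
  exists2 U : {group gT}, chief_factor G N U & U \subset T.
Proof.
move=> nsN nsT ltNT.
have [|U /mingroupP[/andP[nsU ltNU] min] sUT] :=
    @mingroup_exists _ (fun X : {group gT} => (X <| G) && (N \proper X)) T.
  by rewrite nsT.
exists U => //; apply/chief_factorP; split=> // X nsX sNX ltXU.
apply/eqP; apply: contraLR (ltXU) => neqXN.
by rewrite (min X _ (proper_sub ltXU)) ?properxx // nsX properEneq eq_sym neqXN.
Qed.

Lemma quasinilpotentP (gT : finGroupType) (Q : {group gT}) :
  reflect (acts_inner Q Q) (quasinilpotent Q).
Proof.
apply: (iffP forallP) => [qnQ N U chNU | inQ N].
  have /forallP/(_ U) := qnQ N; rewrite chNU => /eqP defQ.
  have [nsN nsU _ _] := chief_factorP _ _ _ chNU.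
  by rewrite -(centsecE nsN (normal_sub nsU)) -defQ.
apply/forallP=> U; apply/implyP=> chNU.
have [nsN nsU _ _] := chief_factorP _ _ _ chNU.
rewrite (centsecE nsN (normal_sub nsU)) eqEsubset (inQ _ _ chNU) /=.
by rewrite mul_subG ?(normal_sub nsU) ?subsetIl.
Qed.

(* Descending along a chief series of G below T, K is successively replaced by
   its intersection with the centraliser of the next chief factor. *)
Lemma acts_inner_split (gT : finGroupType) (G M T : {group gT}) :
  acts_inner G M -> M <| G -> T <| G -> T \subset M ->
  exists K : {group gT}, exists n,
    [/\ K <| G, K \subset M, T * K = M & rcomm T K n = 1].
Proof.
move=> inM nsM nsT sTM.
suff claim (N : {group gT}) : N <| G -> N \subset T ->
    exists K : {group gT}, exists n,
    [/\ K <| G, K \subset M, T * K = M, N \subset K & rcomm T K n \subset N].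
  have [|K [n [nsK sKM defM _ rT]]] := claim 1%G (normal1 _); first exact: sub1G.
  by exists K, n; split=> //; apply/trivgP.
have [m] := ubnP (#|T| - #|N|); elim: m N => // m IH N ltm nsN sNT.
have [eqNT | neqNT] := eqVneq N T.
  by exists M, 0%N; split; rewrite ?eqNT // mulSGid.
have ltNT : N \proper T.
  by rewrite properEneq sNT andbT; apply: contraNneq neqNT => /val_inj->.
have [U chU sUT] := chief_factor_exists nsN nsT ltNT.
have [_ nsU ltNU _] := chief_factorP _ _ _ chU.
have sUG := normal_sub nsU; have sNU := proper_sub ltNU.
have [|K [n [nsK sKM defM sUK rT]]] := IH U _ nsU sUT.
  apply: leq_trans (ltnSE ltm); rewrite ltn_sub2l ?proper_card //.
(* Dedekind's law applies because [U] lies in [K], which is why the claim also asserts that [N] lies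
   in [K]. As [U] lies in [T], the product [T * K] is not affected by the replacement. *)
have defK : U * (K :&: 'C_G(U / N | 'Q)) = K.
  rewrite setIC group_modl //; apply/setIidPr.
  exact: subset_trans sKM (inM _ _ chU).
exists (K :&: 'C_G(U / N | 'Q))%G, (n + 1)%N; split.
- by rewrite normalI // centsecQ_normal.
- by rewrite subIset ?sKM.
- by rewrite -[in RHS]defM -[in RHS]defK mulgA (mulGSid sUT).
- rewrite subsetI (subset_trans sNU) //= sub_centsecQ ?(normal_sub nsN) //.
  by rewrite commg_subr (subset_trans sUG) ?(normal_norm nsN).
rewrite rcommD; apply: subset_trans (centsecQ_comm nsN sUG) => /=.
apply: commgSS (subsetIr _ _); apply: subset_trans rT.
exact: rcomm_sub (subsetIl _ _).
Qed.

Lemma commg_normal2 (gT : finGroupType) (G H K : {group gT}) :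
  H <| G -> K <| G -> [~: H, K] <| G.
Proof.
move=> /andP[sHG nHG] /andP[sKG nKG].
by rewrite /normal comm_subG // normsR.
Qed.

Lemma three_subgroup_mod (gT : finGroupType) (L R G H K : {group gT}) :
  R <| L -> G \subset L -> H \subset L -> K \subset L ->
  [~: G, H, K] \subset R -> [~: H, K, G] \subset R -> [~: K, G, H] \subset R.
Proof.
move=> /andP[sRL nRL] sGL sHL sKL.
have nR (X : {group gT}) : X \subset L -> X \subset 'N(R).
  by move=> sXL; apply: subset_trans nRL.
have q3 (X Y Z : {group gT}) : X \subset L -> Y \subset L -> Z \subset L ->
    ([~: X, Y, Z] \subset R) = ([~: X / R, Y / R, Z / R] == 1).
  move=> sX sY sZ; have sXY : [~: X, Y] \subset L by rewrite comm_subG.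
  rewrite -!quotientR ?nR // -subG1 quotient_sub1 //.
  by rewrite nR // comm_subG.
rewrite !q3 // => /eqP h1 /eqP h2; apply/eqP; exact: three_subgroup.
Qed.

(* With T_j = [T, K, .., K], the three subgroup lemma gives
   [L_i(K), T_j] <= T_(i+j). *)
Lemma rcomm_lcn_cent (gT : finGroupType) (L T K : {group gT}) n :
  T <| L -> K <| L -> rcomm T K n = 1 -> 'L_n.+1(K) \subset 'C(T).
Proof.
move=> nsT nsK rT1.
suff step i j : [~: 'L_i.+1(K), rcomm T K j] \subset rcomm T K (j + i.+1).
  apply/commG1P/trivgP; apply: subset_trans (step n 0%N) _.
  by rewrite add0n rcommS rT1 comm1G.
have nsj k : rcomm T K k <| L.
  by elim: k => //= k IH; apply: (commg_normal2 IH nsK).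
have sTj k := normal_sub (nsj k); have sKL := normal_sub nsK.
elim: i j => [|i IH] j; first by rewrite lcn1 commGC addn1 rcommS.
rewrite lcnSn.
apply: (three_subgroup_mod (nsj (j + i.+2)%N)
          (G := K) (H := rcomm_group T K j) (K := lower_central_at_group i.+1 K)) => //=.
- exact: subset_trans (lcn_sub _ _) sKL.
- by rewrite [[~: K, _]]commGC -rcommS commGC addnS -addSn.
by rewrite addnS rcommS commSg // commGC.
Qed.

(** After [n] steps the lower central series of [K] centralises [T], hence lies in [T]; commuting
    [n] more times with [K] kills it. *)
Lemma nilact_nilpotent (gT : finGroupType) (L T K : {group gT}) n :
  T <| L -> K <| L -> 'C_L(T) \subset T -> rcomm T K n = 1 -> nilpotent K.
Proof.
move=> nsT nsK cT rT1; have sKL := normal_sub nsK.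
have sLT : 'L_n.+1(K) \subset T.
  apply: subset_trans cT; rewrite subsetI (rcomm_lcn_cent nsT nsK) // andbT.
  exact: subset_trans (lcn_sub _ _) sKL.
apply/lcnP; exists (n + n)%N; apply/trivgP; rewrite -rT1.
suff h k : 'L_(n + k).+1(K) \subset rcomm T K k by exact: h.
by elim: k => [|k IH]; rewrite ?addn0 // addnS lcnSn; apply: commSg.
Qed.

Lemma qn_split (gT : finGroupType) (Q T : {group gT}) :
  quasinilpotent Q -> T <| Q ->
  exists K : {group gT}, exists n, [/\ K <| Q, T * K = Q & rcomm T K n = 1].
Proof.
move=> /quasinilpotentP inQ nsT.
have [K [n [nsK _ defQ rT]]] :=
  acts_inner_split inQ (normal_refl _) nsT (normal_sub nsT).
by exists K, n.
Qed.

(** * Permutable subgroups *)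

Definition permutable (gT : finGroupType) (G H : {set gT}) : Prop :=
  forall X : {group gT}, X \subset G -> H * X = X * H.

(** The elementwise form of the fact that a group is never the product of a proper subgroup and one
    of its conjugates. *)
Lemma mulg_conj_eq (gT : finGroupType) (X : {group gT}) y :
  y \in X * X :^ y -> y \in X.
Proof.
case/imset2P=> x z Xx; rewrite mem_conjg => Xz def_y.
have -> : y = (z ^ y^-1) * x; last by rewrite groupM.
by rewrite conjgE invgK {3}def_y invMg !mulgA mulgK mulgKV.
Qed.

Lemma permutableJ (gT : finGroupType) (G H : {group gT}) x :
  x \in G -> permutable G H -> permutable G (H :^ x).
Proof.
move=> Gx pH X sXG; have /pH E : (X :^ x^-1)%G \subset G.
  by rewrite -(conjGid (groupVr Gx)) conjSg.
by rewrite -[gval X](conjsgKV x) -!conjsMg E.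
Qed.

Lemma permutableM (gT : finGroupType) (G H K : {group gT}) :
  permutable G H -> permutable G K -> permutable G (H * K).
Proof.
by move=> pH pK X sXG; rewrite -mulgA pK // mulgA pH // mulgA.
Qed.

Lemma comm_group_setM (gT : finGroupType) (H K : {group gT}) :
  H * K = K * H -> {L : {group gT} | L = H * K :> {set gT}}.
Proof. by move=> /comm_group_setP gHK; exists (Group gHK). Qed.

(* Ore: a maximal proper permutable subgroup M is normal, because M * M :^ y is
   again permutable, and it is G only if y \in M. *)
Lemma permutable_subnormal (gT : finGroupType) (G H : {group gT}) :
  H \subset G -> permutable G H -> H <|<| G.
Proof.
have [n] := ubnP #|G|; elim: n G H => // n IH G H ltGn sHG pH.
have [->|neHG] := eqVneq H G; first exact: subnormal_refl.
have ltHG : H \proper G by rewrite properEneq sHG andbT; apply: contraNneq neHG => /val_inj->.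
pose P (X : {group gT}) := (X \proper G) &&
  [forall Y : {group gT}, (Y \subset G) ==> (X * Y == Y * X)].
have PP (X : {group gT}) : P X -> permutable G X.
  by case/andP=> _ /forallP pX Y sYG; apply/eqP; move/(_ Y): pX; rewrite sYG.
have mkP (X : {group gT}) : X \proper G -> permutable G X -> P X.
  move=> lt pX; rewrite /P lt; apply/forallP=> Y; apply/implyP=> sYG.
  by rewrite pX.
have [M /maxgroupP[PM maxM] sHM] := maxgroup_exists (mkP H ltHG pH).
have ltMG : M \proper G by case/andP: PM.
have pM := PP M PM; have sMG := proper_sub ltMG.
suff nsMG : M <| G.
  apply: subnormal_trans (normal_subnormal nsMG).
  apply: IH sHM _; first exact: leq_trans (proper_card ltMG) _.
  by move=> X sXM; apply: pH; apply: subset_trans sXM sMG.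
rewrite /normal sMG; apply/subsetP=> y Gy; rewrite inE.
have sMyG : (M :^ y)%G \subset G by rewrite /= -(conjGid Gy) conjSg.
have [L defL] := comm_group_setM (pM _ sMyG).
have sML : M \subset L by rewrite defL mulG_subl.
have sMyL : M :^ y \subset L by rewrite defL mulG_subr.
have sLG : L \subset G by rewrite defL mul_subG.
have [ltLG | ] := boolP (L \proper G).
  suff eqLM : L = M :> {set gT} by rewrite -{2}eqLM.
  apply: (maxM L) => //; apply: mkP => //; rewrite defL.
  by apply: permutableM => //; apply: permutableJ.
rewrite properE sLG negbK => sGL.
have : y \in M by apply: mulg_conj_eq; rewrite -defL (subsetP sGL).
by move/conjGid->.
Qed.

(** * Semisimple groups *)

(* Satisfied by the direct products of nonabelian simple groups. *)
Definition semisimple (gT : finGroupType) (N : {group gT}) : Prop :=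
  forall R : {group gT}, R <| N -> R * 'C_N(R) = N /\ R :&: 'C(R) = 1.

(** Characteristic subgroups of [N] are trivial or [N], so the Fitting subgroup of [N] is trivial
    and with it every abelian normal subgroup, such as [R :&: 'C(R)]. Moreover [N] is generated by
    the [G]-conjugates of a minimal normal subgroup of [N], and each of these either lies in [R] or
    meets it trivially and centralises it. *)
Lemma minnormal_semisimple (gT : finGroupType) (G N : {group gT}) :
  minnormal N G -> N \subset G -> ~~ abelian N -> semisimple N.
Proof.
move=> minN sNG nabN; have [ntN nNG min] := minnormalP _ _ minN.
have nchar (X : {group gT}) : X \char N -> X = 1%G \/ X = N.
  move=> chX; have nXG : G \subset 'N(X) by apply: char_norm_trans nNG.
  have [->|ntX] := eqVneq X 1%G; [by left | right; apply/val_inj/min => //].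
  by rewrite (char_sub chX).
have F1 : 'F(N) = 1.
  have [|/(congr1 val)//|/(congr1 val)/= defF] := nchar 'F(N)%G.
    exact: Fitting_char.
  have nilN : nilpotent N by rewrite -defF Fitting_nil.
  have ltN' : N^`(1) \proper N by rewrite (sol_der1_proper (nilpotent_sol nilN)).
  have [|/(congr1 val)/= N'1|/(congr1 val)/= N'] := nchar N^`(1)%G.
  - exact: der_char.
  - by case/negP: nabN; apply/derG1P.
  - by rewrite N' properxx in ltN'.
have abN (X : {group gT}) : X <| N -> abelian X -> X :=: 1.
  move=> nsX cXX; apply/trivgP; rewrite -F1 Fitting_max //; exact: abelian_nil.
have trI (R : {group gT}) : R <| N -> R :&: 'C(R) = 1.
  move=> nsR; apply: (abN (R :&: 'C(R))%G) => /=; last first.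
    by rewrite /abelian subIset // centS ?orbT ?subsetIl // centsC subsetIr.
  by rewrite /normal subIset ?(normal_sub nsR) // normsI ?norms_cent ?normal_norm.
move=> R nsR; split; last exact: trI.
apply/eqP; rewrite eqEsubset mul_subG ?(normal_sub nsR) ?subsetIl //=.
have nRN := normal_norm nsR; have sRN := normal_sub nsR.
have [X minX sXN] := minnormal_exists ntN (normG N).
have [ntX nXN _] := minnormalP _ _ minX.
rewrite -{1}(minnormal_gen_class minN ntX sXN).
have nCN : N \subset 'N('C_N(R)) by rewrite normsI ?normG ?norms_cent.
rewrite -(norm_joinEr (subset_trans (subsetIl _ _) nRN)).
rewrite gen_subG class_supportEr; apply/bigcupsP=> x Gx.
have nNx : x \in 'N(N) by apply: subsetP Gx.
have [ntXx nXxN minXx] := minnormalP _ _ (minnormal_conj nNx minX).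
have sXxN : X :^ x \subset N by rewrite -(normP nNx) conjSg.
have [triv | nt] := eqVneq (X :^ x :&: R) 1.
  apply: subset_trans (joing_subr _ _); rewrite subsetI sXxN /=.
  apply/commG1P/trivgP; rewrite -triv subsetI /=.
  rewrite commg_subl commg_subr (subset_trans sRN) //=.
  exact: subset_trans sXxN nRN.
apply: subset_trans (joing_subl _ _).
by rewrite -(minXx (X :^ x :&: R)%G) ?subsetIr ?subsetIl //= normsI.
Qed.

(** Split [N] along R': the part [X] of [R] centralising R' has X' inside R' and centralising it, so
    X' = 1; an abelian normal [X] is trivial, and R = R' X. *)
Lemma semisimple_perfect (gT : finGroupType) (N R : {group gT}) :
  semisimple N -> R <| N -> R^`(1) = R.
Proof.
move=> ssN nsR.
have nsR' : R^`(1) <| N by apply: char_normal_trans nsR; apply: der_char.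
have [defN tiR'] := ssN _ nsR'.
pose X := (R :&: 'C_N(R^`(1)))%G.
have nsX : X <| N.
  rewrite normalI // /normal subsetIl normsI ?normG ?norms_cent //.
  exact: normal_norm.
have X'1 : X^`(1) \subset R^`(1) :&: 'C(R^`(1)).
  rewrite subsetI dergS ?subsetIl //=.
  by apply: subset_trans (der_sub _ _) _; rewrite /= setIA subsetIr.
have cXX : abelian X by apply/derG1P/trivgP; rewrite -tiR'.
have [_ tiX] := ssN _ nsX.
have X1 : X :=: 1 by rewrite -tiX; apply/esym/setIidPl.
have sR'R : R^`(1) \subset R := der_sub _ _.
have defR : R^`(1) * X = R.
  by rewrite /= [R :&: _]setIC group_modl // defN; apply/setIidPr/normal_sub.
by rewrite -[RHS]defR X1 mulg1.
Qed.

Lemma semisimple_nil (gT : finGroupType) (N R : {group gT}) :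
  semisimple N -> R <| N -> nilpotent R -> R :=: 1.
Proof.
move=> ssN nsR nilR; apply/eqP; apply: contraT => ntR.
have := sol_der1_proper (nilpotent_sol nilR) (subxx _) ntR.
by rewrite (semisimple_perfect ssN nsR) properxx.
Qed.

(** Normality is transitive here: if [L] is normal in [N], then [N] is the product of [L] and
    ['C_N(L)], and the latter centralises every subgroup of [L]. *)
Lemma semisimple_subnormal (gT : finGroupType) (N R : {group gT}) :
  semisimple N -> R <|<| N -> R <| N.
Proof.
move=> ssN; have [n] := ubnP (#|N| - #|R|); elim: n R => // n IH R ltn snR.
have [<-|[L [nsRL snL ltRL]]] := subnormalEl snR; first exact: normal_refl.
have nsL : L <| N.
  apply: (IH _ _ snL); apply: leq_trans (ltnSE ltn).
  have ltc := proper_card ltRL.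
  have := subset_leq_card (subnormal_sub snL).
  by move=> h; rewrite ltn_sub2l // (leq_trans ltc).
have [defN _] := ssN _ nsL.
rewrite /normal (subset_trans (normal_sub nsRL) (normal_sub nsL)) /=.
rewrite -{1}defN mul_subG ?(normal_norm nsRL) //.
rewrite subIset // (subset_trans (centS (normal_sub nsRL)) (cent_sub _)) ?orbT //.
Qed.

(** The centraliser of [S] is normal, hence perfect, and a commutator [r s, w] of its elements, with
    r in [R] and s in [S], is [r, w] conjugated by s, which lies in [R]. *)
Lemma semisimple_factor (gT : finGroupType) (N R S : {group gT}) :
  semisimple N -> R <| N -> S <| N -> R * S = N -> 'C_N(S) \subset R.
Proof.
move=> ssN nsR nsS defN; have [defN2 _] := ssN _ nsS.
have nsZ : 'C_N(S) <| N.
  by rewrite /normal subsetIl normsI ?normG ?norms_cent ?normal_norm.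
have := semisimple_perfect ssN nsZ; rewrite /= => <-.
rewrite gen_subG; apply/subsetP=> _ /imset2P[z w Zz Zw ->].
have [Nz cz] := setIP Zz; move: (Nz); rewrite -defN.
case/imset2P=> r s Rr Ss ->.
have [Nw cw] := setIP Zw.
have -> : [~ r * s, w] = [~ r, w] ^ s.
  have /commgP/eqP cs1 : commute s w by apply: commute_sym; apply: (centP cw).
  by rewrite commMgJ cs1 mulg1.
have nR := subsetP (normal_norm nsR).
rewrite memJ_norm ?nR ?(subsetP (normal_sub nsS)) //.
by rewrite commgEl groupM ?groupV // memJ_norm ?nR.
Qed.

(** * Subnormal subgroups of mutually permutable products *)

Local Notation mp := mutually_permutable.

Lemma mp_sym (gT : finGroupType) (G A B : {group gT}) : mp G A B -> mp G B A.
Proof.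
case=> defG pA pB; split=> //.
by rewrite -(pA B) ?defG.
Qed.

Lemma mp_subl (gT : finGroupType) (G A B : {group gT}) : mp G A B -> A \subset G.
Proof. by case=> <- _ _; rewrite mulG_subl. Qed.

Lemma mp_subr (gT : finGroupType) (G A B : {group gT}) : mp G A B -> B \subset G.
Proof. by move/mp_sym/mp_subl. Qed.

Lemma mp_joinl (gT : finGroupType) (G A B X : {group gT}) :
  mp G A B -> X \subset A -> {L : {group gT} | L = B * X :> {set gT}}.
Proof. by case=> _ _ pB sXA; apply: comm_group_setM; apply: pB. Qed.

Lemma mp_joinr (gT : finGroupType) (G A B Y : {group gT}) :
  mp G A B -> Y \subset B -> {L : {group gT} | L = A * Y :> {set gT}}.
Proof. by move/mp_sym; apply: mp_joinl. Qed.

Lemma mp_factorized (gT : finGroupType) (G A B L : {group gT}) :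
  mp G A B -> (A :&: L) * (B :&: L) = L -> mp L (A :&: L) (B :&: L).
Proof.
move=> mpG defL; have [_ pA pB] := mpG; split=> // U.
  rewrite /= subsetI => /andP[sUB sUL].
  by rewrite /= [A :&: L]setIC group_modr // pA // [LHS]setIC -group_modl // setIC.
rewrite /= subsetI => /andP[sUA sUL].
by rewrite /= [B :&: L]setIC group_modr // pB // [LHS]setIC -group_modl // setIC.
Qed.

Lemma mp_overl (gT : finGroupType) (G A B L : {group gT}) :
  mp G A B -> A \subset L -> L \subset G -> mp L A (B :&: L).
Proof.
move=> mpG sAL sLG; have [defG _ _] := mpG.
have defA : (A :&: L)%G = A by apply/val_inj/setIidPl.
rewrite -{1}defA; apply: (mp_factorized mpG).
by rewrite /= (setIidPl sAL) group_modl // defG; apply/setIidPr.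
Qed.

Lemma mp_quotient (gT : finGroupType) (G A B N : {group gT}) :
  G \subset 'N(N) -> mp G A B -> mp (G / N) (A / N) (B / N).
Proof.
move=> nNG mpG; have [defG pA pB] := mpG.
have nNA := subset_trans (mp_subl mpG) nNG.
have nNB := subset_trans (mp_subr mpG) nNG.
have lift (X : {group coset_of N}) (C : {group gT}) : X \subset C / N ->
    exists2 Y : {group gT}, Y \subset C & Y / N = X.
  move=> sXC; exists (C :&: coset N @*^-1 X)%G; first exact: subsetIl.
  by rewrite quotientIG ?sub_cosetpre // cosetpreK; apply/setIidPr.
split=> [|U sU|U sU]; first by rewrite /= -quotientMl // defG.
  have [Y sYB <-] := lift _ _ sU; rewrite -!quotientMl ?pA //.
  exact: subset_trans sYB nNB.
have [Y sYB <-] := lift _ _ sU; rewrite -!quotientMl ?pB //.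
exact: subset_trans sYB nNA.
Qed.

Lemma mp_permutableI (gT : finGroupType) (G A B : {group gT}) :
  mp G A B -> permutable A (A :&: B).
Proof.
case=> _ _ pB X sXA.
by rewrite group_modr // pB // [LHS]setIC -group_modl // setIC.
Qed.

Lemma cyclic_der1_cent (gT : finGroupType) (A N : {group gT}) :
  cyclic N -> A \subset 'N(N) -> A^`(1) \subset 'C(N).
Proof.
move=> cycN nNA.
have nNA' : A^`(1) \subset 'N(N) := subset_trans (der_sub 1 A) nNA.
have : conj_aut N @* A^`(1) = 1.
  rewrite morphim_der //; apply/derG1P.
  by apply: abelianS (Aut_conj_aut _ _) (Aut_cyclic_abelian cycN).
move/trivgP; rewrite sub_morphim_pre //.
by rewrite -kerE ker_conj_aut.
Qed.

(** If [Q, X, X] = 1, then [X] centralises Q / [Q, X]; fixed points lift under coprime action, so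
    [X] centralises Q. Taking Q to be an iterated commutator lowers [m] by one. *)
Lemma coprime_rcomm (gT : finGroupType) (P X : {group gT}) m :
  X \subset 'N(P) -> coprime #|P| #|X| -> solvable P -> rcomm P X m = 1 ->
  X \subset 'C(P).
Proof.
have nil2 (Q : {group gT}) : X \subset 'N(Q) -> coprime #|Q| #|X| ->
    solvable Q -> [~: Q, X, X] = 1 -> [~: Q, X] = 1.
  move=> nQX coQX solQ R1.
  have sRQ : [~: Q, X] \subset Q by rewrite commg_subl.
  have nRX : X \subset 'N([~: Q, X]) by rewrite commg_normr.
  have sRC : [~: Q, X] \subset 'C_Q(X) by rewrite subsetI sRQ; apply/commG1P.
  have := coprime_norm_quotient_cent nQX nRX (coprimeSg sRQ coQX) (solvableS sRQ solQ).
  have -> : 'C_(Q / [~: Q, X])(X / [~: Q, X]) = Q / [~: Q, X].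
    apply/setIidPl; apply: quotient_cents2r; exact: subxx.
  move=> eqQ; apply/commG1P; apply: subset_trans (subsetIr Q _).
  have nRQ : Q \subset 'N([~: Q, X]) by rewrite commg_norml.
  by rewrite -(quotientSGK nRQ sRC) eqQ.
move=> nPX coPX solP; elim: m => [/= P1|[|m] IH rP].
- by rewrite P1 cents1.
- by rewrite centsC; apply/commG1P.
apply: IH; have sP : rcomm P X m \subset P by apply: rcomm_sub_id.
apply: (nil2 (rcomm_group P X m)) => //.
- by case: m {rP sP} => //= m; rewrite commg_normr.
- exact: coprimeSg coPX.
- exact: solvableS solP.
Qed.

(* For y \in B :\: A with y ^+ r \in A, r prime, A * <[y]> meets N in a normal
   subgroup of G, so it is G and N has order r. *)
Lemma mp_abelian_minnormal (gT : finGroupType) (G A B N : {group gT}) :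
  mp G A B -> A :!=: G -> minnormal N G -> abelian N -> A * N = G ->
  A :&: N = 1 -> 'C_A(N) = 1 -> abelian A.
Proof.
move=> mpG neAG minN cNN defG tiAN cAN1; have [ntN nNG min] := minnormalP _ _ minN.
have [defG2 _ _] := mpG.
have sAG := mp_subl mpG; have sBG := mp_subr mpG.
have sNG : N \subset G by rewrite -defG mulG_subr.
have nNA := subset_trans sAG nNG.
(* Automorphism groups of cyclic groups are abelian, so A' centralises [N] once |N| is prime, and
   ['C_A(N)] is trivial. *)
suff prN : prime #|N|.
  apply/derG1P/trivgP; rewrite -cAN1 subsetI der_sub.
  by rewrite cyclic_der1_cent ?prime_cyclic.
have [y0 Py0] : exists y, y \in B :\: A.
  apply/set0Pn; rewrite setD_eq0; apply: contra neAG => sBA.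
  by rewrite -defG2 mulGSid.
(* The order of [y] is chosen minimal, so that the power [y ^+ r], of smaller order, falls into
   [A]. *)
case: (@arg_minnP _ y0 (mem (B :\: A)) (fun y => #[y]) Py0) => y.
rewrite !inE => /andP[notAy By] miny {y0 Py0}.
have nty : y != 1 by apply: contraNneq notAy => ->.
pose r := pdiv #[y]; have prr : prime r by rewrite pdiv_prime // order_gt1.
have Ayr : y ^+ r \in A.
  apply: contraT => notA; have := miny (y ^+ r).
  rewrite !inE notA groupX // => /(_ isT).
  rewrite orderXdiv ?pdiv_dvd // leqNgt ltn_Pdiv ?order_gt0 ?prime_gt1 //.
have syB : <[y]> \subset B by rewrite cycle_subG.
have [L defL] := mp_joinr mpG syB.
have sAL : A \subset L by rewrite defL mulG_subl.
have sLG : L \subset G by rewrite defL -defG2 mulgS.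
have defL2 : A * (N :&: L) = L.
  by rewrite group_modl // defG; apply/setIidPr.
have ntLN : N :&: L != 1.
  apply: contraNneq notAy => NL1; rewrite -[A : {set _}]mulg1 -NL1 defL2 defL.
  by rewrite (subsetP (mulG_subr _ _)) ?cycle_id.
have nLN : N :&: L = N.
  apply: (min (N :&: L)%G) => //; rewrite ?subsetIl //=.
  rewrite -defG mul_subG //; first exact: normsI nNA (normsG sAL).
  by apply: sub_abelian_norm => //; apply: subsetIl.
have eLG : L :=: G by rewrite -defL2 nLN.
have cN : #|N| = #|<[y]> : A|.
  by rewrite -(indexMg A) -defL eLG -defG indexMg -indexgI setIC tiAN indexg1.
have syA : <[y ^+ r]> \subset <[y]> :&: A.
  by rewrite subsetI cycleX cycle_subG.
have iyr : #|<[y]> : <[y ^+ r]>| = r.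
  rewrite -divgS ?cycleX // -!orderE orderXdiv ?pdiv_dvd //.
  by rewrite divnA ?pdiv_dvd // mulKn ?order_gt0.
have : #|N| %| r by rewrite cN -indexgI -iyr indexgS.
by case/primeP: (prr) => _ h /h/orP[|/eqP->//]; rewrite -trivg_card1 (negbTE ntN).
Qed.

(* For Y a Sylow q-subgroup of B, A * Y meets N in an A-invariant Sylow
   q-subgroup, on which A' acts nilpotently.  So an element of order r in A'
   centralises Sylow q-subgroups of N for all q != r, hence [N, x] is an
   r-group. *)
Lemma mp_semisimple_TI (gT : finGroupType) (G A B N : {group gT}) :
  mp G A B -> minnormal N G -> ~~ abelian N -> A * N = G ->
  A :&: N = 1 -> 'C_A(N) = 1 ->
  (forall L : {group gT}, A \subset L -> L \proper G -> A^`(1) <|<| L) ->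
  abelian A.
Proof.
move=> mpG minN nabN defG tiAN cAN1 IH; have [ntN nNG min] := minnormalP _ _ minN.
have [defG2 _ _] := mpG.
have sAG := mp_subl mpG; have sBG := mp_subr mpG.
have sNG : N \subset G by rewrite -defG mulG_subr.
have nNA := subset_trans sAG nNG.
have ssN := minnormal_semisimple minN sNG nabN.
have nilN (X : {group gT}) : X <| N -> nilpotent X -> X :=: 1.
  exact: semisimple_nil.
have syl q : prime q -> exists P : {group gT},
    [/\ q.-Sylow(N) P, A \subset 'N(P) &
        exists m, rcomm P A^`(1) m = 1].
  move=> prq; have [Y sylY] := Sylow_exists q B.
  have [sYB qY _] := and3P sylY.
  have [L defL] := mp_joinr mpG sYB.
  have sAL : A \subset L by rewrite defL mulG_subl.
  have sLG : L \subset G by rewrite defL -defG2 mulgS.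
  have defL2 : A * (N :&: L) = L.
    by rewrite group_modl // defG; apply/setIidPr.
  have cNL : #|N :&: L| = #|Y : A|.
    rewrite -(indexMg A) -defL -[in RHS]defL2 indexMg -indexgI.
    by rewrite setIAC [N :&: A]setIC tiAN setI1g indexg1.
  have qNL : q.-group (N :&: L).
    by rewrite /pgroup cNL (pnat_dvd _ qY) // dvdn_indexg.
  have nNL : A \subset 'N(N :&: L) by apply: normsI nNA (normsG sAL).
  have ltLG : L \proper G.
    rewrite properEneq sLG andbT; apply: contraNneq ntN => eLG.
    rewrite (nilN N) // -(setIidPl sNG) -eLG; exact: pgroup_nil qNL.
  exists (N :&: L)%G; split=> //.
    (* Both [N] and [B] supplement [L] in [G], so |N : N :&: L| = |B : B :&: L|, which divides the
       index of the Sylow subgroup [Y] in [B]. *)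
    rewrite /pHall subsetIl qNL indexgI /=.
    have e1 : L * N = G.
      by apply/eqP; rewrite eqEsubset mul_subG //= -{1}defG mulSg.
    have e2 : L * B = G.
      by apply/eqP; rewrite eqEsubset mul_subG //= -{1}defG2 mulSg.
    rewrite -indexMg e1 -e2 indexMg -indexgI.
    have [_ _] := and3P sylY; apply: pnat_dvd; apply: indexgS.
    by rewrite subsetI sYB defL mulG_subr.
  have nsNL : (N :&: L)%G <| L.
    rewrite /normal subsetIr; exact: normsI (subset_trans sLG nNG) (normG L).
  have [m rm] := rcomm_subnormalI (U := (N :&: L)%G) (G := L) (K := A^`(1)%G)
     nsNL (IH L sAL ltLG).
  exists m; apply/trivgP; apply: subset_trans rm _.
  by rewrite -tiAN setIC; apply: setISS (der_sub _ _) (subsetIl _ _).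
apply/derG1P/eqP; apply: contraT => ntA'.
pose r := pdiv #|A^`(1)|.
have prr : prime r by rewrite pdiv_prime // cardG_gt1.
have [x A'x ox] := Cauchy prr (pdiv_dvd _).
have rx : r.-group <[x]> by rewrite /pgroup -orderE ox pnat_id.
have sxA' : <[x]> \subset A^`(1) by rewrite cycle_subG.
have sxA := subset_trans sxA' (der_sub 1 A).
suff cNx : <[x]> \subset 'C_A(N).
  by move: cNx; rewrite cAN1 cycle_subG => /set1P x1; move: prr; rewrite -ox x1 order1.
rewrite subsetI sxA /=.
have cent_q q (P : {group gT}) : q != r -> q.-Sylow(N) P -> A \subset 'N(P) ->
    (exists m, rcomm P A^`(1) m = 1) -> <[x]> \subset 'C(P).
  move=> neqr sylP nPA [m rm]; have [sPN qP _] := and3P sylP.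
  apply: (coprime_rcomm (m := m)) => //.
  - exact: subset_trans sxA nPA.
  - by apply: pnat_coprime qP _; apply: pi_pnat rx _; rewrite !inE eq_sym.
  - by apply: nilpotent_sol; apply: pgroup_nil qP.
  by apply/trivgP; rewrite -rm rcomm_sub.
have [P [sylP nPA _]] := syl r prr; have [sPN rP _] := and3P sylP.
have nNx : <[x]> \subset 'N(N) := subset_trans sxA nNA.
(* The index of ['C_N(<[x]>)] is a power of [r], as this centraliser contains a Sylow q-subgroup of
   [N] for every q other than [r]. Since [x] normalises [P], commutators with [x] fall into [P];
   thus [N, x] is a nilpotent normal subgroup of [N], which is semisimple. *)
have defN : 'C_N(<[x]>) * P = N.
  apply: coprime_index_mulG; rewrite ?subsetIl //.
  rewrite (@pnat_coprime r) //; last by case/and3P: sylP.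
  apply/pnatP=> // q prq qd.
  apply: contraT => neqr; have [S [sylS nSA rS]] := syl q prq.
  have cSx := cent_q q S neqr sylS nSA rS.
  have [sSN _ q'S] := and3P sylS.
  have : q %| #|N : S|.
    by apply: dvdn_trans qd _; apply: indexgS; rewrite subsetI sSN centsC.
  by apply: contraLR => _; rewrite -p'natE.
have sRP : [~: N, <[x]>] \subset P.
  rewrite gen_subG; apply/subsetP=> _ /imset2P[n z Nn xz ->].
  move: Nn; rewrite -defN => /imset2P[c s /setIP[_ cc] Ps ->].
  have /commgP/eqP c1 : commute c z by apply: (centP cc).
  rewrite commMgJ c1 conj1g mul1g commgEl groupM ?groupV // memJ_norm //.
  by rewrite (subsetP nPA) // (subsetP sxA).
rewrite centsC; apply/commG1P; apply: (nilN [~: N, <[x]>]%G).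
  by rewrite /normal commg_norml andbT commg_subl.
exact: pgroup_nil (pgroupS sRP rP).
Qed.

(** By Dedekind's law and [A :&: B = 1], the product [X * Y] is the intersection of the groups
    [B * X] and [A * Y]. *)
Lemma mp_TI_permute (gT : finGroupType) (G A B X Y : {group gT}) :
  mp G A B -> A :&: B = 1 -> X \subset A -> Y \subset B -> X * Y = Y * X.
Proof.
move=> mpG tiAB sXA sYB; have [_ _ pB] := mpG.
have [L1 defL1] := mp_joinl mpG sXA; have [L2 defL2] := mp_joinr mpG sYB.
have sXL2 : X \subset L2 by rewrite defL2 (subset_trans sXA) ?mulG_subl.
suff defXY : X * Y = L1 :&: L2.
  by apply/comm_group_setP; rewrite defXY groupP.
have <- : B :&: L2 = Y by rewrite defL2 -group_modr // setIC tiAB mul1g.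
by rewrite group_modl // -pB // defL1.
Qed.

(** If [y] moves [X], then [X] and [X :^ y] meet trivially, and their product has at least |X| |Y|
    elements. It therefore fills the group [X * Y] and contains [y], which forces [y] into [X]. *)
Lemma prime_order_normalize (gT : finGroupType) (X Y : {group gT}) :
  X * Y = Y * X -> prime #|X| -> (#|Y| <= #|X|)%N -> Y \subset 'N(X).
Proof.
move=> cXY prX leYX; have [L defL] := comm_group_setM cXY.
have sXL : X \subset L by rewrite defL mulG_subl.
apply/subsetP=> y Yy; rewrite inE; apply: contraT => nsXy.
have Ly : y \in L by rewrite defL (subsetP (mulG_subr _ _)).
have tiX : X :&: X :^ y = 1.
  apply: prime_TIg => //; apply: contra nsXy => sXXy.
  have : X :==: X :^ y by rewrite eqEcard sXXy cardJg /=.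
  by move/eqP=> <-.
have : y \in X * X :^ y.
  suff -> : X * X :^ y = L by [].
  apply/eqP; rewrite eqEcard mul_subG //=; last by rewrite -(conjGid Ly) conjSg.
  rewrite (TI_cardMg tiX) cardJg defL.
  apply: (@leq_trans (#|X| * #|Y|)); last by rewrite leq_mul.
  by rewrite mul_cardG leq_pmulr.
by move/mulg_conj_eq => Xy; rewrite conjGid ?subxx in nsXy.
Qed.

(** Being simple, [A] is generated by its elements x of order [r] and [B] by its elements y of prime
    order. The groups generated by x and by y permute, and the order of y is at most [r], so y
    normalises the group generated by x. *)
Lemma mp_TI_simple_normal (gT : finGroupType) (G A B : {group gT}) r :
  mp G A B -> A :&: B = 1 -> prime r -> r %| #|A| -> B :!=: 1 ->
  (forall q, prime q -> q %| #|B| -> q <= r)%N ->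
  (forall K : {group gT}, K <| A -> K :!=: 1 -> K :=: A) ->
  (forall K : {group gT}, K <| B -> K :!=: 1 -> K :=: B) ->
  A <| G.
Proof.
move=> mpG tiAB prr rA ntB maxr simA simB.
pose A0 := <<[set x in A | #[x] == r]>>%G.
have defA : A0 :=: A.
  apply: simA.
    rewrite /normal gen_subG; apply/andP; split.
      by apply/subsetP=> x; rewrite inE => /andP[].
    apply: norms_gen; apply/subsetP=> a Aa; rewrite inE; apply/subsetP=> _ /imsetP[x + ->].
    by rewrite !inE orderJ groupJr.
  have [x Ax ox] := Cauchy prr rA.
  apply/trivgPn; exists x; last by rewrite -order_gt1 ox prime_gt1.
  by apply: mem_gen; rewrite inE Ax ox eqxx.
pose B0 := <<[set x in B | prime #[x]]>>%G.
have defB : B0 :=: B.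
  apply: simB.
    rewrite /normal gen_subG; apply/andP; split.
      by apply/subsetP=> x; rewrite inE => /andP[].
    apply: norms_gen; apply/subsetP=> a Aa; rewrite inE; apply/subsetP=> _ /imsetP[x + ->].
    by rewrite !inE orderJ groupJr.
  have prq : prime (pdiv #|B|) by rewrite pdiv_prime ?cardG_gt1.
  have [x Bx ox] := Cauchy prq (pdiv_dvd _).
  apply/trivgPn; exists x; last by rewrite -order_gt1 ox prime_gt1.
  by apply: mem_gen; rewrite inE Bx ox.
have [defG _ _] := mpG.
rewrite /normal (mp_subl mpG) -defG mul_subG ?normG //= -defB gen_subG.
apply/subsetP=> y; rewrite inE => /andP[By pry].
rewrite -defA -sub1set; apply: norms_gen; rewrite sub1set.
rewrite inE; apply/subsetP=> _ /imsetP[x + ->].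
rewrite !inE => /andP[Ax /eqP ox].
rewrite orderJ ox eqxx andbT.
have : <[y]> \subset 'N(<[x]>).
  apply: prime_order_normalize; rewrite -?orderE ?ox //.
    by apply: (mp_TI_permute mpG tiAB); rewrite cycle_subG.
  by apply: maxr => //; apply: order_dvdG.
rewrite cycle_subG => /normP nxy.
have : x ^ y \in <[x]> by rewrite -nxy memJ_conjg cycle_id.
by apply: subsetP; rewrite cycle_subG.
Qed.

(* Otherwise a normal subgroup of B containing A :&: B and different from B lies
   in the core of a proper subgroup A * Y, so A :&: B = 1 and A, B are simple;
   the factor whose order has the largest prime divisor is then normal. *)
Lemma mp_simple (gT : finGroupType) (G A B : {group gT}) :
  mp G A B -> simple G -> A :!=: 1 -> A :=: G.
Proof.
move=> mpG /simpleP[ntG simG] ntA; apply/eqP; apply: contraT => neAG.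
have sAG := mp_subl mpG; have sBG := mp_subr mpG; have [defG pA pB] := mpG.
have snG (X : {group gT}) : X <|<| G -> X :=: 1 \/ X :=: G.
  have [n] := ubnP (#|G| - #|X|); elim: n X => // n IH X ltn snX.
  have [<-|[L [nsXL snL ltXL]]] := subnormalEl snX; first by right.
  have [L1|LG] : L :=: 1 \/ L :=: G.
  - apply: (IH _ _ snL); apply: leq_trans (ltnSE ltn).
    have ltc := proper_card ltXL.
    have := subset_leq_card (subnormal_sub snL).
    by move=> h; rewrite ltn_sub2l // (leq_trans ltc).
  - by left; apply/trivgP; rewrite -L1 normal_sub.
  by apply: simG; rewrite -LG.
have neBG : B :!=: G.
  apply: contraNneq ntA => eBG; have [|A1|eAG] := snG A.
  - by apply: permutable_subnormal => // X sXG; apply: pA; rewrite eBG.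
  - exact/eqP.
  by rewrite eAG eqxx in neAG.
have core (C E : {group gT}) : mp G C E -> forall Y : {group gT}, Y <| E ->
    Y :!=: E -> C :&: E \subset Y -> Y :=: 1.
  move=> mpC Y nsY neYE sDY; have [defGC _ _] := mpC; have sYE := normal_sub nsY.
  have [L defL] := mp_joinr mpC sYE.
  have sCL : C \subset L by rewrite defL mulG_subl.
  have sYL : Y \subset L by rewrite defL mulG_subr.
  have neLG : L :!=: G.
    apply: contra neYE => /eqP eLG; apply/eqP.
    have /setIidPl <- : E \subset L by rewrite eLG -defGC mulG_subr.
    by rewrite defL -group_modr // setIC mulSGid.
  have sYcore : Y \subset gcore L G.
    apply/bigcapsP=> x; rewrite -{1}defGC => /imset2P[c e Cc Ee ->].
    rewrite conjsgM (conjGid (subsetP sCL c Cc)).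
    by rewrite -(normsP (normal_norm nsY) e Ee) conjSg.
  have nsc : gcore L G <| G.
    rewrite /normal gcore_norm andbT (subset_trans (gcore_sub _ _)) //.
    by rewrite defL -defGC mulgS.
  case: (simG _ nsc) => /= eqc; first by apply/trivgP; rewrite -eqc.
  case/eqP: neLG; apply/eqP; rewrite eqEsubset -{2}eqc gcore_sub andbT.
  by rewrite defL -defGC mulgS.
(* Being permutable in [C], the intersection lies in a proper normal subgroup of [C], which [core],
   with the factors exchanged, shows to be trivial. *)
have Dsn (C E : {group gT}) : mp G C E -> E :!=: G -> C :&: E = 1.
  move=> mpC neEG; have [defGC _ _] := mpC.
  have neDC : C :&: E != C.
    apply: contra neEG => /eqP/setIidPl sCE; apply/eqP.
    by rewrite -defGC mulSGid.
  have snD : C :&: E <|<| C.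
    by apply: permutable_subnormal; [apply: subsetIl | apply: mp_permutableI mpC].
  case: (subnormalEr snD) => [eDC | [K [snK nsK ltK]]].
    by rewrite eDC eqxx in neDC.
  have K1 : K :=: 1.
    apply: (core E C (mp_sym mpC)) => //; first by rewrite proper_neq.
    by rewrite setIC subnormal_sub.
  by apply/trivgP; rewrite -K1 subnormal_sub.
have tiAB : A :&: B = 1 by apply: Dsn mpG neBG.
have ntB : B :!=: 1 by apply: contraNneq neAG => B1; rewrite -defG B1 mulg1.
have simA (K : {group gT}) : K <| A -> K :!=: 1 -> K :=: A.
  move=> nsK; apply: contraNeq => neK; apply/eqP.
  by apply: (core B A (mp_sym mpG)) => //; rewrite setIC tiAB sub1G.
have simB (K : {group gT}) : K <| B -> K :!=: 1 -> K :=: B.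
  move=> nsK; apply: contraNeq => neK; apply/eqP.
  by apply: (core A B mpG) => //; rewrite tiAB sub1G.
pose a := max_pdiv #|A|; pose b := max_pdiv #|B|.
have pra : prime a by rewrite max_pdiv_prime ?cardG_gt1.
have prb : prime b by rewrite max_pdiv_prime ?cardG_gt1.
have maxp (C : {group gT}) q : prime q -> q %| #|C| -> (q <= max_pdiv #|C|)%N.
  by move=> prq qC; apply: max_pdiv_max; rewrite mem_primes prq cardG_gt0.
have [leba|/ltnW leab] := leqP b a.
  have nsA : A <| G.
    apply: (mp_TI_simple_normal mpG tiAB pra (max_pdiv_dvd _) ntB) => // q prq qB.
    exact: leq_trans (maxp _ _ prq qB) leba.
  by case: (simG _ nsA) => E; rewrite ?E eqxx in neAG ntA.
have nsB : B <| G.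
  rewrite setIC in tiAB.
  apply: (mp_TI_simple_normal (mp_sym mpG) tiAB prb (max_pdiv_dvd _) ntA) => // q prq qB.
  exact: leq_trans (maxp _ _ prq qB) leab.
by case: (simG _ nsB) => E; rewrite ?E eqxx in neBG ntB.
Qed.

(* Ito: conjugation by a1 * b1 and by b1 * a1 have the same effect on [~ a, b]. *)
Lemma abelian_mul_der1_abelian (gT : finGroupType) (G A B : {group gT}) :
  A * B = G -> abelian A -> abelian B -> abelian G^`(1).
Proof.
move=> defG cAA cBB.
have cA x y : x \in A -> y \in A -> commute x y by move=> Ax; apply: (centsP cAA).
have cB x y : x \in B -> y \in B -> commute x y by move=> Bx; apply: (centsP cBB).
have sAG : A \subset G by rewrite -defG mulG_subl.
have sBG : B \subset G by rewrite -defG mulG_subr.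
have defG2 : B * A = G.
  by rewrite -defG; apply/esym/comm_group_setP; rewrite defG groupP.
have nRA : A \subset 'N([~: A, B]) by apply: commg_norml.
have nRB : B \subset 'N([~: A, B]) by apply: commg_normr.
have defG' : G^`(1) = [~: A, B].
  apply/eqP; rewrite eqEsubset (commgSS sAG sBG) andbT.
  apply: der1_min; first by rewrite -defG mul_subG.
  rewrite -defG quotientMl // abelianM !quotient_abelian //=.
  by rewrite ?(centsC (B / _)) quotient_cents2r.
have comm1 (x y : gT) : commute x y -> [~ x, y] = 1 by move=> c; apply/eqP/commgP.
have conj_comm a b a1 b1 : a \in A -> b \in B -> a1 \in A -> b1 \in B ->
    ([~ a, b] ^ a1) ^ b1 = ([~ a, b] ^ b1) ^ a1.
  move=> Aa Bb Aa1 Bb1.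
  have : b ^ a1 \in A * B.
    by rewrite defG groupJ ?(subsetP sAG a1) ?(subsetP sBG b).
  case/imset2P=> a2 b2 Aa2 Bb2 eb.
  have : a ^ b1 \in B * A.
    by rewrite defG2 groupJ ?(subsetP sAG a) ?(subsetP sBG b1).
  case/imset2P=> b3 a3 Bb3 Aa3 ea.
  have ca x : x \in A -> [~ x, b ^ a1] = [~ x, b2].
    by move=> Ax; rewrite eb commgMJ (comm1 x a2 (cA _ _ Ax Aa2)) conj1g mulg1.
  have cb y : y \in B -> [~ a ^ b1, y] = [~ a3, y].
    by move=> By; rewrite ea commMgJ (comm1 b3 y (cB _ _ Bb3 By)) conj1g mul1g.
  have fa (x y : gT) : x \in A -> y \in A -> x ^ y = x.
    by move=> Ax Ay; apply/conjg_fixP/eqP/comm1/cA.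
  have fb (x y : gT) : x \in B -> y \in B -> x ^ y = x.
    by move=> Bx By; apply/conjg_fixP/eqP/comm1/cB.
  rewrite [[~ a, b] ^ a1]conjRg (fa a a1) // ca // conjRg (fb b2 b1) // cb //.
  by rewrite [[~ a, b] ^ b1]conjRg (fb b b1) // cb // conjRg (fa a3 a1) // ca.
rewrite defG' /abelian gen_subG; apply/subsetP=> _ /imset2P[a b Aa Bb ->].
rewrite -sub1set centsC gen_subG; apply/subsetP=> _ /imset2P[a1 b1 Aa1 Bb1 ->].
rewrite /= cent_set1; apply/cent1P/commgP/conjg_fixP.
have -> : [~ a, b] = (a^-1 * b^-1) * (a * b) by rewrite commgEl conjgE !mulgA.
rewrite conjgM [_ ^ (a^-1 * b^-1)]conjgM conj_comm ?groupV // -!conjgM.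
by rewrite -?mulgA mulKg mulVg conjg1.
Qed.

Lemma cosetpre_subnormal (gT : finGroupType) (N G : {group gT})
    (H : {group coset_of N}) :
  N <| G -> H <|<| G / N -> coset N @*^-1 H <|<| G.
Proof.
have [n] := ubnP #|G|; elim: n G => // n IH G ltn nsNG /subnormalEr[eH | ].
  by rewrite eH quotientGK // subnormal_refl.
case=> L [snHL nsL ltL].
have nsP : coset N @*^-1 L <| G.
  by rewrite -(quotientGK nsNG) cosetpre_normal.
apply: subnormal_trans (normal_subnormal nsP).
apply: (IH (coset N @*^-1 L)%G) => /=.
- apply: leq_trans (ltnSE ltn); apply: proper_card.
  by rewrite -(quotientGK nsNG) cosetpre_proper.
- by rewrite normal_cosetpre.
by rewrite cosetpreK.
Qed.

(** The product of [A :&: N] and [B :&: N] is the trace on [N] both of a group containing [B] and of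
    a group containing [A], so both factors normalise it; minimality of [N] leaves two cases. *)
Lemma mp_minnormal_cap (gT : finGroupType) (G A B N : {group gT}) :
  mp G A B -> minnormal N G -> N \subset G ->
  A :&: N = 1 /\ B :&: N = 1 \/ (A :&: N) * (B :&: N) = N.
Proof.
move=> mpG /minnormalP[ntN nNG min] sNG; have [defG pA pB] := mpG.
have [L1 defL1] := mp_joinl mpG (subsetIl A N).
have [L2 defL2] := mp_joinr mpG (subsetIl B N).
have e1 : (A :&: N) * (B :&: N) = L1 :&: N.
  by rewrite group_modl ?subsetIr // -pB ?subsetIl // defL1.
have e2 : (A :&: N) * (B :&: N) = L2 :&: N.
  by rewrite [A :&: N]setIC group_modr ?subsetIr // defL2 setIC.
have nL : G \subset 'N(L1 :&: N).
  rewrite -{1}defG mul_subG //.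
    rewrite -e1 e2; apply: normsI; last exact: subset_trans (mp_subl mpG) nNG.
    by rewrite normsG // defL2 mulG_subl.
  apply: normsI; last exact: subset_trans (mp_subr mpG) nNG.
  by rewrite normsG // defL1 mulG_subl.
have [L1N|nt] := eqVneq (L1 :&: N) 1.
  left; split; apply/trivgP; rewrite -L1N -e1.
    exact: mulG_subl.
  exact: mulG_subr.
by right; rewrite e1; apply: (min (L1 :&: N)%G) => //; apply: subsetIr.
Qed.

(** Otherwise [N] is the mutually permutable product of W = [A :&: N] and V = [B :&: N], and [N] is
    not [G] by the simple case. By induction W' and V' are normal in [N]. Then W' is normal in G = A
    N and lies in [A], so W is abelian; the perfect group N / V' is metabelian by Ito, so V = N. Now
    W is permutable in [N], hence normal and abelian, hence trivial. *)
Lemma mp_semisimple_nTI (gT : finGroupType) (G A B N : {group gT}) :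
  mp G A B -> A :!=: G -> minnormal N G -> ~~ abelian N -> A * N = G ->
  (forall X : {group gT}, X <| G -> X \subset A -> X :=: 1) ->
  (N \proper G -> forall A1 B1 : {group gT}, mp N A1 B1 -> A1^`(1) <|<| N) ->
  A :&: N = 1.
Proof.
move=> mpG neAG minN nabN defG coreA IH; apply/eqP; apply: contraT => ntW.
have sNG : N \subset G by rewrite -defG mulG_subr.
have ssN := minnormal_semisimple minN sNG nabN.
have defN : (A :&: N) * (B :&: N) = N.
  have [[E _]|//] := mp_minnormal_cap mpG minN sNG.
  by rewrite E eqxx in ntW.
have mpN := mp_factorized mpG defN.
have [ntN nNG min] := minnormalP _ _ minN.
have [eNG|neNG] := eqVneq N G.
  case/eqP: neAG; apply: (mp_simple mpG); first by rewrite -eNG in minN *.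
  by apply: subG1_contra ntW; apply: subsetIl.
have ltNG : N \proper G.
  by rewrite properEneq sNG andbT; apply: contraNneq neNG => /val_inj->.
have nsW' := semisimple_subnormal ssN (IH ltNG _ _ mpN).
have nsV' := semisimple_subnormal ssN (IH ltNG _ _ (mp_sym mpN)).
have cWW : abelian (A :&: N).
  apply/derG1P; apply: (coreA (A :&: N)^`(1)%G) => /=; last first.
    exact: subset_trans (der_sub _ _) (subsetIl _ _).
  rewrite /normal (subset_trans (normal_sub nsW')) //=.
  rewrite -{1}defG mul_subG ?(normal_norm nsW') //.
  apply: char_norm_trans (der_char _ _) _.
  by apply: normsI (normG _) (subset_trans (mp_subl mpG) nNG).
have eVN : B :&: N = N.
  have cQ : abelian (N / (B :&: N)^`(1))^`(1).
    apply: (@abelian_mul_der1_abelian _ (N / (B :&: N)^`(1))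
             ((A :&: N) / (B :&: N)^`(1)) ((B :&: N) / (B :&: N)^`(1))).
    - rewrite /= -quotientMl ?defN //.
      exact: subset_trans (subsetIr _ _) (normal_norm nsV').
    - exact: quotient_abelian.
    - exact: sub_der1_abelian.
  have perfN := semisimple_perfect ssN (normal_refl N).
  move: cQ; rewrite -quotient_der ?(normal_norm nsV') // perfN => cQ.
  have := der1_min (normal_norm nsV') cQ; rewrite perfN => sN.
  apply/eqP; rewrite eqEsubset subsetIr; exact: subset_trans sN (der_sub _ _).
have nsW : (A :&: N)%G <| N.
  apply: semisimple_subnormal => //; apply: permutable_subnormal (subsetIr _ _) _.
  by have [_ pW _] := mpN; move=> X sXN; apply: pW; rewrite /= eVN.
by rewrite (semisimple_nil ssN nsW (abelian_nil cWW)) eqxx in ntW.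
Qed.

Lemma quotient_subnormal_mul (gT : finGroupType) (N G K : {group gT}) :
  N <| G -> K \subset G -> K / N <|<| G / N -> N <*> K <|<| G.
Proof.
move=> nsN sKG snK; have nNK := subset_trans sKG (normal_norm nsN).
have := cosetpre_subnormal (H := (K / N)%G) nsN snK.
by rewrite quotientK // norm_joinEr.
Qed.

(** A nontrivial normal subgroup of [G] inside [A] would contain some minimal normal [N], giving G =
    A N = A. In particular ['C_A(N)] is trivial, being normalised by [A] and by [N], if [A :&: N]
    is; for abelian [N] the intersection [A :&: N] is itself normal in [G]. *)
Lemma mp_corefree_abelian (gT : finGroupType) (G A B : {group gT}) :
  mp G A B -> A :!=: G ->
  (forall L A1 B1 : {group gT}, L \proper G -> mp L A1 B1 -> A1^`(1) <|<| L) ->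
  (forall N : {group gT}, minnormal N G -> N \subset G -> A * N = G) ->
  abelian A.
Proof.
move=> mpG neAG IH supA; have sAG := mp_subl mpG.
have ntG : G :!=: 1.
  by apply: contraNneq neAG => G1; rewrite eqEsubset sAG G1 sub1G.
have coreA (X : {group gT}) : X <| G -> X \subset A -> X :=: 1.
  move=> /andP[sXG nXG] sXA; apply/eqP; apply: contraT => ntX.
  have [N minN sNX] := minnormal_exists ntX nXG.
  case/eqP: neAG; rewrite -(supA N minN (subset_trans sNX sXG)).
  by rewrite mulGSid // (subset_trans sNX).
have [N minN sNG] := minnormal_exists ntG (normG G).
have [ntN nNG min] := minnormalP _ _ minN.
have defG := supA N minN sNG; have nNA := subset_trans sAG nNG.
have cAN1 : A :&: N = 1 -> 'C_A(N) = 1.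
  move=> tiAN; apply: (coreA 'C_A(N)%G) => /=; last exact: subsetIl.
  rewrite /normal subIset ?sAG //= -{1}defG mul_subG //.
    by rewrite normsI ?normG ?norms_cent.
  by rewrite cents_norm // centsC subsetIr.
have [cNN|nabN] := boolP (abelian N).
  have tiAN : A :&: N = 1.
    apply: (coreA (A :&: N)%G) => /=; last exact: subsetIl.
    rewrite /normal subIset ?sAG //= -{1}defG mul_subG //.
      by rewrite normsI ?normG.
    by rewrite sub_abelian_norm ?subsetIr.
  exact: mp_abelian_minnormal mpG neAG minN cNN defG tiAN (cAN1 tiAN).
have tiAN : A :&: N = 1.
  by apply: (mp_semisimple_nTI mpG) => // ltNG A1 B1; apply: IH.
apply: (mp_semisimple_TI mpG minN nabN defG tiAN (cAN1 tiAN)) => L sAL ltLG.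
exact: IH ltLG (mp_overl mpG sAL (proper_sub ltLG)).
Qed.

(** If A N is not [G] for some minimal normal [N], then N A' is subnormal in [G] by induction in G /
    N, and A' is subnormal in A N by induction. For the intersection, the group AN :&: BN plays this
    role. If no such [N] exists, [A], respectively both [A] and [B], is abelian, so that A' = 1,
    respectively [A :&: B] is central. A factor equal to [G] makes the other one permutable, hence
    subnormal, in [G]. *)
Theorem mp_subnormal (gT : finGroupType) (G A B : {group gT}) :
  mp G A B -> A^`(1) <|<| G /\ A :&: B <|<| G.
Proof.
have [n] := ubnP #|G|; elim: n gT G A B => // n IH gT G A B ltn mpG.
have [defG pA pB] := mpG; have sAG := mp_subl mpG; have sBG := mp_subr mpG.
have snder (C : {group gT}) : C <|<| G -> C^`(1) <|<| G.
  by apply: subnormal_trans; apply: normal_subnormal; apply: der_normal.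
have [eAG|neAG] := eqVneq (A : {set gT}) G.
  have snB : B <|<| G.
    by apply: permutable_subnormal => // X sXG; apply: pB; rewrite eAG.
  split; first by apply: snder; rewrite (_ : A = G) ?subnormal_refl //; apply/val_inj.
  by rewrite eAG (setIidPr sBG).
have [eBG|neBG] := eqVneq (B : {set gT}) G.
  have snA : A <|<| G.
    by apply: permutable_subnormal => // X sXG; apply: pA; rewrite eBG.
  by split; [exact: snder | rewrite eBG (setIidPl sAG)].
have ltcard (L : {group gT}) : L \proper G -> #|L| < n.
  by move/proper_card=> lt; apply: leq_trans lt (ltnSE ltn).
have ltq (N : {group gT}) : N <| G -> N :!=: 1 -> #|G / N| < n.
  move=> nsN ntN; apply: leq_trans (ltnSE ltn).
  by rewrite ltn_quotient ?normal_sub.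
have corefree (C E : {group gT}) : mp G C E -> C :!=: G ->
    (forall N : {group gT}, minnormal N G -> N \subset G -> C * N = G) ->
    abelian C.
  move=> mpC neC; apply: (mp_corefree_abelian mpC neC) => L A1 B1 ltL mpL.
  by have [] := IH _ _ _ _ (ltcard _ ltL) mpL.
split.
  pose P (N : {group gT}) := [&& minnormal N G, N \subset G & A * N != G].
  have [/existsP[N /and3P[minN sNG neANG]] | /existsPn noN] := boolP [exists N, P N]; last first.
    have cAA : abelian A.
      apply: (corefree A B) => // N minN sNG.
      by have := noN N; rewrite /P minN sNG /= negbK => /eqP.
    by rewrite (derG1P cAA) normal_subnormal ?normal1.
  have [ntN nNG _] := minnormalP _ _ minN.
  have nsN : N <| G by rewrite /normal sNG.
  have sA'G := subset_trans (der_sub 1 A) sAG.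
  have nNA := subset_trans sAG nNG.
  have [snq _] := IH _ _ _ _ (ltq N nsN ntN) (mp_quotient nNG mpG).
  have snK : N <*> A^`(1) <|<| G.
    apply: quotient_subnormal_mul => //.
    by rewrite quotient_der.
  apply: subnormal_trans snK.
  pose L := (A <*> N)%G; have defL : L :=: A * N by rewrite /= norm_joinEl.
  have ltLG : L \proper G by rewrite properEneq defL neANG mul_subG.
  have sAL : A \subset L by rewrite joing_subl.
  have [snL _] := IH _ _ _ _ (ltcard _ ltLG) (mp_overl mpG sAL (proper_sub ltLG)).
  have sKL : N <*> A^`(1) \subset L.
    by rewrite join_subG joing_subr (subset_trans (der_sub _ _)).
  have := setI_subnormal sKL snL.
  by rewrite (setIidPl (joing_subr _ _)).
pose M (N : {group gT}) := (A <*> N :&: B <*> N)%G.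
pose P (N : {group gT}) := [&& minnormal N G, N \subset G & M N \proper G].
have [/existsP[N /and3P[minN sNG ltMG]] | /existsPn noN] := boolP [exists N, P N].
  have [ntN nNG _] := minnormalP _ _ minN.
  have nsN : N <| G by rewrite /normal sNG.
  have nNA := subset_trans sAG nNG; have nNB := subset_trans sBG nNG.
  have [_ snq] := IH _ _ _ _ (ltq N nsN ntN) (mp_quotient nNG mpG).
  have sNM : N \subset M N by rewrite subsetI !joing_subr.
  have snM : M N <|<| G.
    have -> : M N = (N <*> M N)%G.
      by apply/val_inj; rewrite /= (joing_idPr sNM).
    apply: quotient_subnormal_mul => //; first exact: proper_sub.
    by rewrite /= quotientIG ?joing_subr //= !quotientYidr //.
  have defM : (A :&: M N) * (B :&: M N) = M N.
    have eB : B :&: M N = B :&: (A <*> N).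
      by rewrite /= setICA (setIidPl (joing_subl B N)) setIC.
    rewrite [A :&: _]setIC group_modr ?subsetIr // eB.
    rewrite group_modl ?joing_subl // defG (setIidPr (_ : A <*> N \subset G)); last by rewrite join_subG sAG.
    by apply/setIidPl; apply: subsetIl.
  have [_ sn] := IH _ _ _ _ (ltcard _ ltMG) (mp_factorized mpG defM).
  apply: subnormal_trans snM; move: sn.
  rewrite /= setIACA setIid (setIidPl _) //.
  by apply: setISS; apply: joing_subl.
have allN (N : {group gT}) : minnormal N G -> N \subset G -> A * N = G /\ B * N = G.
  move=> minN sNG; have [_ nNG _] := minnormalP _ _ minN.
  have nNA := subset_trans sAG nNG; have nNB := subset_trans sBG nNG.
  have sMG : M N \subset G by rewrite subIset // join_subG sAG sNG.
  have := noN N; rewrite /P minN sNG properE sMG /= negbK.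
  rewrite subsetI !norm_joinEl // => /andP[sGA sGB].
  by split; apply/eqP; rewrite eqEsubset mul_subG.
have cAA : abelian A by apply: (corefree A B) => // N minN /(allN N minN)[].
have cBB : abelian B by apply: (corefree B A) => // [|N minN /(allN N minN)[]]; first exact: mp_sym.
apply: normal_subnormal; rewrite /normal subIset ?sAG //= -{1}defG mul_subG //.
  by rewrite cents_norm // centsC subIset // [A \subset _]cAA.
by rewrite cents_norm // centsC subIset // [B \subset _]cBB orbT.
Qed.

(** * Mutually permutable products of quasinilpotent groups *)

Lemma subnormal_TI_cent (gT : finGroupType) (G U S : {group gT}) :
  minnormal U G -> U \subset G -> S <|<| G -> U :&: S = 1 -> S \subset 'C(U).
Proof.
move=> minU sUG snS tiUS; have [_ nUG _] := minnormalP _ _ minU.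
have nsU : U <| G by rewrite /normal sUG.
have [m rm] := rcomm_subnormalI nsU snS.
apply: (subnormal_nilact_minnormal minU snS (m := m)).
by apply/trivgP; rewrite -tiUS.
Qed.

(** Split [Q] as R K with R = [S :&: U] and K nilpotent on R. Then S is R times [K :&: S], and the
    latter centralises [U]: it is subnormal, so iterated commutators bring [U] into R, where K acts
    nilpotently. *)
Lemma qn_subnormal_inner (gT : finGroupType) (G Q S U : {group gT}) :
  quasinilpotent Q -> S <| Q -> S <|<| G -> Q \subset G ->
  minnormal U G -> U \subset G -> S \subset U * 'C_G(U).
Proof.
move=> qnQ nsSQ snSG sQG minU sUG; have [_ nUG _] := minnormalP _ _ minU.
have nsU : U <| G by rewrite /normal sUG.
have sSG := subnormal_sub snSG.
have nsR : (S :&: U)%G <| Q.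
  rewrite /normal subIset ?(normal_sub nsSQ) //=.
  by rewrite normsI ?(normal_norm nsSQ) // (subset_trans sQG).
have [K [n [nsK defQ rK]]] := qn_split qnQ nsR.
have defS : (S :&: U) * (K :&: S) = S.
  by rewrite group_modl ?subsetIl // defQ; apply/setIidPr/normal_sub.
have snKS : (K :&: S)%G <|<| G.
  apply: subnormal_trans snSG; apply: normal_subnormal.
  rewrite /normal subsetIr normsI ?normG //.
  exact: subset_trans (normal_sub nsSQ) (normal_norm nsK).
have [m rm] := rcomm_subnormalI nsU snKS.
rewrite -defS mulgSS ?subsetIr // subsetI subIset ?sSG ?orbT //=.
apply: (subnormal_nilact_minnormal minU snKS (m := (m + n)%N)).
apply/trivgP; rewrite /= -rK rcommD; apply: rcomm_sub; last exact: subsetIl.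
apply: subset_trans rm _; rewrite /= setIC.
exact: setSI (subsetIr K S).
Qed.

(** [Q] is R K with K nilpotent on [R], and the abelian factor [R] contributes nothing to
    commutators with elements of [R]. *)
Lemma qn_abelian_normal (gT : finGroupType) (Q R : {group gT}) :
  quasinilpotent Q -> R <| Q -> abelian R -> exists n, rcomm R Q n = 1.
Proof.
move=> qnQ nsR cRR; have [K [n [nsK defQ rK]]] := qn_split qnQ nsR.
have nRK : K \subset 'N(R) := subset_trans (normal_sub nsK) (normal_norm nsR).
exists n; apply/trivgP; rewrite -rK; elim: n {rK} => //= n IH.
apply: subset_trans (commSg _ IH) _.
have sXR : rcomm R K n \subset R by apply: rcomm_sub_id.
rewrite gen_subG; apply/subsetP=> _ /imset2P[x y Xx Qy ->].
move: Qy; rewrite -defQ => /imset2P[r k Rr Kk ->].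
have /commgP/eqP xr1 : commute x r.
  by apply: (centsP cRR) => //; apply: (subsetP sXR).
by rewrite commgMJ xr1 conj1g mulg1 mem_commg.
Qed.

(** The complement-like factor K acts nilpotently on [R], so [R :&: K] is nilpotent and therefore
    trivial; it contains [R, K]. *)
Lemma qn_normal_cent (gT : finGroupType) (Q R : {group gT}) :
  quasinilpotent Q -> R <| Q ->
  (forall X : {group gT}, X <| R -> nilpotent X -> X :=: 1) ->
  exists K : {group gT}, [/\ K <| Q, R * K = Q & K \subset 'C(R)].
Proof.
move=> qnQ nsR nilR; have [K [n [nsK defQ rK]]] := qn_split qnQ nsR.
exists K; split=> //.
have nRK : K \subset 'N(R) := subset_trans (normal_sub nsK) (normal_norm nsR).
have nKR : R \subset 'N(K) := subset_trans (normal_sub nsR) (normal_norm nsK).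
have tiRK : R :&: K = 1.
  apply: (nilR (R :&: K)%G) => /=; first by rewrite /normal subsetIl normsI ?normG.
  apply/lcnP; exists n; apply/trivgP; rewrite -rK.
  have h j : 'L_j.+1(R :&: K) \subset rcomm R K j.
    elim: j => [|j IH]; first by rewrite lcn1 subsetIl.
    by rewrite lcnSn rcommS commgSS ?subsetIr.
  exact: h.
rewrite centsC; apply/commG1P/trivgP; rewrite -tiRK subsetI.
by rewrite commg_subl nRK commg_subr nKR.
Qed.

(* U is the product of its normal subgroups RA = A' :&: U and RB = B' :&: U; the
   centraliser in U of RB lies in RA and is normal in G, so RA or RB is U. *)
Lemma mp_inner_nonabelian (gT : finGroupType) (G A B U : {group gT}) :
  mp G A B -> quasinilpotent A -> quasinilpotent B ->
  minnormal U G -> U \subset G -> ~~ abelian U -> G^`(1) \subset U * 'C_G(U).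
Proof.
move=> mpG qnA qnB minU sUG nabU; have [ntU nUG min] := minnormalP _ _ minU.
have [defG _ _] := mpG; have sAG := mp_subl mpG; have sBG := mp_subr mpG.
have ssU := minnormal_semisimple minU sUG nabU.
have perfU := semisimple_perfect ssU (normal_refl U).
have nCG : G \subset 'N('C_G(U)) by rewrite normsI ?normG ?norms_cent.
have [snA' _] := mp_subnormal mpG; have [snB' _] := mp_subnormal (mp_sym mpG).
pose J := (U <*> 'C_G(U))%G.
have defJ : J = U * 'C_G(U) :> {set gT}.
  by rewrite /= norm_joinEr // subIset // nUG.
have nJG : G \subset 'N(J) by rewrite normsY.
have nsder (C : {group gT}) : C^`(1) <| C := der_normal 1 C.
have sA'J : A^`(1) \subset J.
  by rewrite defJ; apply: (qn_subnormal_inner qnA (nsder A)).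
have sB'J : B^`(1) \subset J.
  by rewrite defJ; apply: (qn_subnormal_inner qnB (nsder B)).
rewrite -defJ.
have nJA := subset_trans sAG nJG; have nJB := subset_trans sBG nJG.
have doneA : A \subset J -> G^`(1) \subset J.
  move=> sAJ; apply: der1_min => //.
  rewrite -defG quotientMl // (quotientS1 sAJ) mul1g.
  exact: sub_der1_abelian.
have doneB : B \subset J -> G^`(1) \subset J.
  move=> sBJ; apply: der1_min => //.
  rewrite -defG quotientMl // (quotientS1 sBJ) mulg1.
  exact: sub_der1_abelian.
(* By Ito's theorem the second derived subgroup of [H] lies in [N], and it contains the perfect
   group [U]. *)
have metab (H X Y N : {group gT}) : X * Y = H -> H \subset 'N(N) ->
    X^`(1) \subset N -> Y^`(1) \subset N -> U \subset H -> U \subset N.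
  move=> defH nNH sX' sY' sUH.
  have nNX : X \subset 'N(N) by apply: subset_trans nNH; rewrite -defH mulG_subl.
  have cQ : abelian (H / N)^`(1).
    apply: (@abelian_mul_der1_abelian _ (H / N) (X / N) (Y / N)).
    - by rewrite /= -quotientMl // defH.
    - exact: sub_der1_abelian.
    - exact: sub_der1_abelian.
  rewrite -quotient_der // in cQ.
  have nNH' := subset_trans (der_sub 1 H) nNH.
  have sH'' : H^`(1)^`(1) \subset N := der1_min nNH' cQ.
  have sUH' : U \subset H^`(1) by rewrite -perfU dergS.
  by apply: subset_trans sH''; rewrite -{1}perfU dergS.
have [[tiA tiB] | defU] := mp_minnormal_cap mpG minU sUG.
  have cent1 (S C : {group gT}) : S <|<| G -> S \subset C -> C \subset G ->
      C :&: U = 1 -> S \subset 'C_G(U).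
    move=> snS sSC sCG tiC; rewrite subsetI (subset_trans sSC) //=.
    apply: (subnormal_TI_cent minU) => //.
    by apply/trivgP; rewrite /= -tiC [U :&: S]setIC setSI.
  have /subsetIP[_ cUU] : U \subset 'C_G(U).
    apply: (metab G A B 'C_G(U)%G) => //.
      exact: (cent1 A^`(1)%G A) (der_sub _ _) _ _.
    exact: (cent1 B^`(1)%G B) (der_sub _ _) _ _.
  by rewrite /abelian cUU in nabU.
pose RA := (A^`(1) :&: U)%G; pose RB := (B^`(1) :&: U)%G.
have nsRA : RA <| U := semisimple_subnormal ssU (setI_subnormal sUG snA').
have nsRB : RB <| U := semisimple_subnormal ssU (setI_subnormal sUG snB').
have defU2 : RA * RB = U.
  have nsRR : RA <*> RB <| U by rewrite normalY.
  apply/eqP; rewrite eqEsubset mul_subG ?(normal_sub nsRA) ?(normal_sub nsRB) //=.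
  rewrite -norm_joinEr; last exact: subset_trans (normal_sub nsRB) (normal_norm nsRA).
  apply: (metab U (A :&: U)%G (B :&: U)%G (RA <*> RB)%G) => //.
  - exact: normal_norm.
  - apply: subset_trans (joing_subl _ _); rewrite subsetI dergS ?subsetIl //=.
    exact: subset_trans (der_sub _ _) (subsetIr _ _).
  apply: subset_trans (joing_subr _ _); rewrite subsetI dergS ?subsetIl //=.
  exact: subset_trans (der_sub _ _) (subsetIr _ _).
have decomp (Q R : {group gT}) : quasinilpotent Q -> Q \subset G ->
    R = (Q^`(1) :&: U)%G -> R <| U ->
    exists K : {group gT}, [/\ K <| Q, R * K = Q & K \subset 'C(R)].
  move=> qnQ sQG eR nsR; apply: qn_normal_cent => //.
    rewrite eR /normal subIset ?der_sub //= normsI ?(normal_norm (nsder Q)) //.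
    exact: subset_trans sQG nUG.
  move=> X nsX nilX; apply: (semisimple_nil ssU) nilX.
  apply: semisimple_subnormal => //; apply: subnormal_trans (normal_subnormal nsX) _.
  exact: normal_subnormal.
have [KA [_ defA cKA]] := decomp A RA qnA sAG (erefl _) nsRA.
have [KB [_ defB cKB]] := decomp B RB qnB sBG (erefl _) nsRB.
have full (Q K : {group gT}) : Q \subset G -> U * K = Q -> K \subset 'C(U) -> Q \subset J.
  move=> sQG defQ cK; rewrite defJ -defQ mulgS // subsetI cK andbT.
  by apply: subset_trans sQG; rewrite -defQ mulG_subr.
pose Z := 'C_U(RB)%G.
have nsZ : Z <| U.
  by rewrite /normal subsetIl normsI ?normG ?norms_cent ?(normal_norm nsRB).
have sZRA : Z \subset RA by apply: (semisimple_factor ssU).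
(* On the side of [A] = [RA * KA]: [RA] lies in [U], which normalises [Z], and [KA] centralises
   [RA], which contains [Z]. *)
have nZG : G \subset 'N(Z).
  rewrite -defG mul_subG //.
    rewrite -defA mul_subG //.
      exact: subset_trans (normal_sub nsRA) (normal_norm nsZ).
    apply: subset_trans cKA _; apply: subset_trans (cent_sub _); exact: centS.
  have nUB := subset_trans sBG nUG.
  have nRB : B \subset 'N(RB) by apply: normsI nUB; apply: der_norm.
  exact: normsI nUB (norms_cent nRB).
have [Z1|ntZ] := eqVneq (Z : {set gT}) 1.
  have eU : RB = U :> {set gT}.
    by have [<- _] := ssU _ nsRB; rewrite (_ : 'C_U(RB) = 1) // mulg1.
  by apply/doneB/(full B KB sBG); rewrite -eU; [exact: defB | exact: cKB].
have eZ : Z = U :> {set gT} by apply: (min Z) => //; apply: subsetIl.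
have eU : RA = U :> {set gT}.
  by apply/eqP; rewrite eqEsubset (normal_sub nsRA) -eZ.
by apply/doneA/(full A KA sAG); rewrite -eU; [exact: defA | exact: cKA].
Qed.

(** * Action on abelian minimal normal subgroups *)

Lemma pgroup_cent_nontrivial (gT : finGroupType) (P U : {group gT}) (p : nat) :
  p.-group P -> p.-group U -> P \subset 'N(U) -> U :!=: 1 -> 'C_U(P) != 1.
Proof.
move=> pP pU nUP ntU.
have pPU : p.-group (U <*> P) by rewrite norm_joinEr // pgroupM pU pP.
have nsU : U <| U <*> P by rewrite /normal joing_subl join_subG normG.
have nt := meet_center_nil (pgroup_nil pPU) nsU ntU.
apply: subG1_contra nt.
by rewrite setIS // subIset // centS ?orbT ?joing_subr.
Qed.

Lemma nilact_cent_nontrivial (gT : finGroupType) (K U : {group gT}) n :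
  U :!=: 1 -> K \subset 'N(U) -> rcomm U K n = 1 -> 'C_U(K) != 1.
Proof.
move=> ntU nUK; elim: n => [/= U1|n IH rU]; first by rewrite U1 eqxx in ntU.
have [/IH//|nt] := eqVneq (rcomm U K n) 1.
apply: subG1_contra nt; rewrite subsetI rcomm_sub_id //.
exact/commG1P.
Qed.

(** [L] is generated by ['C_L(U)] and a Sylow p-subgroup, which has nontrivial fixed points on the
    p-group [U]. So ['C_U(L)] is nontrivial and normalised by [G]. *)
Lemma minnormal_pquot_cent (gT : finGroupType) (G U L : {group gT}) (p : nat) :
  minnormal U G -> U \subset G -> p.-group U -> L <| G ->
  p.-group (L / 'C_G(U)) -> L \subset 'C(U).
Proof.
move=> /minnormalP[ntU nUG min] sUG pU /andP[sLG nLG] pL.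
have nCL : L \subset 'N('C_G(U)).
  by apply: subset_trans sLG _; rewrite normsI ?normG ?norms_cent.
have [P sylP] := Sylow_exists p L; have [sPL pP p'P] := and3P sylP.
have defL : 'C_L(U) * P = L.
  apply: coprime_index_mulG; rewrite ?subsetIl // (@pnat_coprime p) //.
  have -> : #|L : 'C_L(U)| = #|L / 'C_G(U)|.
    rewrite card_quotient // -[LHS]divgI -[RHS]divgI.
    by rewrite !setIA setIid (setIidPl sLG).
  exact: pL.
have ntC : 'C_U(L) != 1.
  have nUP := subset_trans sPL (subset_trans sLG nUG).
  apply: subG1_contra (pgroup_cent_nontrivial pP pU nUP ntU).
  have eC : 'C(L) = 'C('C_L(U)) :&: 'C(P) by rewrite -centM defL.
  rewrite /= subsetI subsetIl /= eC subsetI subsetIr andbT.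
  by rewrite subIset // centsC subsetIr.
have eU : 'C_U(L) = U.
  by apply: (min 'C_U(L)%G) => //=; rewrite ?subsetIl // normsI // norms_cent.
by rewrite centsC -eU subsetIr.
Qed.

Lemma minnormal_norm_cyclic (gT : finGroupType) (G U : {group gT}) :
  minnormal U G -> (forall X : {group gT}, X \subset U -> G \subset 'N(X)) ->
  cyclic U.
Proof.
move=> /minnormalP[ntU nUG min] nX; have [x Ux ntx] := trivgPn _ ntU.
have sxU : <[x]> \subset U by rewrite cycle_subG.
by rewrite -(min <[x]>%G) ?cycle_cyclic ?nX //= cycle_eq1.
Qed.

(** In the group L generated by [B] and [x], the index of [B] is prime to [p], so the normal
    p-subgroup [L :&: U] lies in [B]. Thus [B :&: U] equals [L :&: U], which [x] normalises. *)
Lemma mp_p'elt_norm (gT : finGroupType) (G A B U : {group gT}) (p : nat) x :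
  mp G A B -> U <| G -> p.-group U -> x \in A -> p^'.-elt x ->
  x \in 'N(B :&: U).
Proof.
move=> mpG nsU pU Ax p'x.
have sxA : <[x]> \subset A by rewrite cycle_subG.
have [L defL] := mp_joinl mpG sxA; have [defG pA pB] := mpG.
have sBL : B \subset L by rewrite defL mulG_subl.
have Lx : x \in L by rewrite defL (subsetP (mulG_subr _ _)) ?cycle_id.
have sLG : L \subset G by rewrite defL pB // -defG mulSg.
have nsN : L :&: U <| L := normalGI sLG nsU.
have sNB : L :&: U \subset B.
  rewrite -indexg_eq1 -dvdn1 -(@part_pnat_id p #|L :&: U : B|); last first.
    by apply: pnat_dvd (dvdn_indexg _ _) _; apply: pgroupS (subsetIr _ _) pU.
  rewrite dvdn1; apply/eqP; apply: part_p'nat.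
  have : p^'.-nat #|L : B|.
    by rewrite defL indexMg; apply: pnat_dvd (dvdn_indexg _ _) p'x.
  apply: pnat_dvd; rewrite -(indexMg B) -norm_joinEl; last first.
    by rewrite (subset_trans sBL) // normal_norm.
  by apply: indexSg; rewrite ?joing_subl // join_subG sBL subsetIl.
have -> : B :&: U = L :&: U.
  by apply/eqP; rewrite eqEsubset setSI //= subsetI sNB subsetIr.
exact: (subsetP (normal_norm nsN)).
Qed.

Lemma cent_minnormal_normal (gT : finGroupType) (G U : {group gT}) :
  G \subset 'N(U) -> 'C_G(U) <| G.
Proof. by move=> nUG; rewrite /normal subsetIl normsI ?normG ?norms_cent. Qed.

Lemma minnormal_pquot_trivial (gT : finGroupType) (G U : {group gT}) (p : nat)
    (Z : {group coset_of 'C_G(U)}) :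
  minnormal U G -> U \subset G -> p.-group U -> Z <| G / 'C_G(U) ->
  p.-group Z -> Z :=: 1.
Proof.
move=> minU sUG pU nsZ pZ; have [_ nUG _] := minnormalP _ _ minU.
have nsC := cent_minnormal_normal nUG.
have nsL : coset 'C_G(U) @*^-1 Z <| G.
  by rewrite -[X in _ <| X](quotientGK nsC) cosetpre_normal.
have sL : coset 'C_G(U) @*^-1 Z \subset 'C(U).
  by apply: (minnormal_pquot_cent minU sUG pU nsL); rewrite cosetpreK.
by rewrite -(cosetpreK Z) quotientS1 // subsetI normal_sub.
Qed.

(* X is the intersection of U with the group B * (A :&: B1 * X), where
   B1 = B :&: A * U. *)
Lemma mp_TI_norm (gT : finGroupType) (G A B U X : {group gT}) :
  mp G A B -> U <| G -> B :&: U = 1 -> B :&: (A <*> U) \subset 'C(U) ->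
  X \subset U -> B \subset 'N(X).
Proof.
move=> mpG /andP[sUG nUG] tiBU cB1 sXU; have [defG pA pB] := mpG.
have nUA := subset_trans (mp_subl mpG) nUG.
pose E := ((B :&: (A <*> U)) <*> X)%G.
have defE : E = (B :&: (A <*> U)) * X :> {set gT}.
  apply: cent_joinEr; rewrite centsC; apply: subset_trans cB1 _; exact: centS.
have [L defL] := mp_joinl mpG (subsetIl A E).
have sBL : B \subset L by rewrite defL mulG_subl.
suff defX : L :&: U = X.
  rewrite -defX normsI ?(normsG sBL) //; exact: subset_trans (mp_subr mpG) nUG.
apply/setP=> u; apply/setIP/idP=> [[] | Xu].
  rewrite defL => /imset2P[b y Bb /setIP[_]].
  rewrite defE => /imset2P[b1 x /setIP[Bb1 _] Xx ->] -> Uu.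
  have : b * b1 \in B :&: U.
    rewrite inE groupM //= -(groupMr _ (subsetP sXU x Xx)) -mulgA.
    exact: Uu.
  by rewrite tiBU mulgA => /set1P->; rewrite mul1g.
have Uu := subsetP sXU u Xu; split=> //.
have : u \in B * A by have [-> _ _] := mp_sym mpG; apply: (subsetP sUG).
case/imset2P=> b a Bb Aa eu; rewrite defL eu mem_mulg // inE Aa defE /=.
have -> : a = b^-1 * u by rewrite eu mulKg.
rewrite mem_mulg // inE !groupV Bb /= norm_joinEl //.
have -> : b = u * a^-1 by rewrite eu mulgK.
rewrite -norm_joinEl // groupM ?groupV //.
  by rewrite (subsetP (joing_subr _ _)).
by rewrite (subsetP (joing_subl _ _)).
Qed.

(** Modulo ['C_G(U)], the group [B :&: (A <*> U)] is a p-group, its index over [A] being |U|, and it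
    is central, lying in the images of both abelian factors; so it is trivial. Hence [B], and
    likewise [A], normalises every subgroup of [U], and [U] is cyclic. *)
Lemma mp_TI_inner (gT : finGroupType) (G A B U : {group gT}) (p : nat) :
  mp G A B -> minnormal U G -> U \subset G -> p.-group U -> abelian U ->
  A^`(1) \subset 'C_G(U) -> B^`(1) \subset 'C_G(U) ->
  A :&: U = 1 -> B :&: U = 1 -> A :&: B \subset 'C(U) ->
  G^`(1) \subset 'C_G(U).
Proof.
move=> mpG minU sUG pU cUU cA' cB' tiA tiB cD.
have [_ nUG _] := minnormalP _ _ minU; have nsU : U <| G by rewrite /normal sUG.
have nsC := cent_minnormal_normal nUG; have nCG := normal_norm nsC.
have sUC : U \subset 'C_G(U) by rewrite subsetI sUG.
have central (C E : {group gT}) : mp G C E -> C^`(1) \subset 'C_G(U) ->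
    E^`(1) \subset 'C_G(U) -> C :&: U = 1 -> C :&: E \subset 'C(U) ->
    E :&: (C <*> U) \subset 'C(U).
  move=> mpC cC' cE' tiC cCE; have [defG _ _] := mpC.
  have sCG := mp_subl mpC; have sEG := mp_subr mpC.
  have nUC := subset_trans sCG nUG.
  have nCC := subset_trans sCG nCG; have nCE := subset_trans sEG nCG.
  pose S := (E :&: (C <*> U))%G.
  have sSG : S \subset G by rewrite subIset ?sEG.
  have nCS := subset_trans sSG nCG.
  have cardS : #|S : C| = #|U|.
    have defCU : C * S = C <*> U.
      by rewrite group_modl ?joing_subl // defG; apply/setIidPr; rewrite join_subG sCG.
    by rewrite -(indexMg C) defCU norm_joinEl // indexMg -indexgI setIC tiC indexg1.
  have pS : p.-group (S / 'C_G(U)).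
    rewrite /pgroup card_quotient //; apply: pnat_dvd (_ : p.-nat #|S : C|).
      rewrite -(indexgI S C); apply: indexgS; rewrite subsetI subIset ?sSG //=.
      apply: subset_trans cCE; rewrite setIC setIS //; exact: subsetIl.
    by rewrite cardS.
  have cS : G / 'C_G(U) \subset 'C(S / 'C_G(U)).
    have -> : G / 'C_G(U) = (C / 'C_G(U)) * (E / 'C_G(U)) by rewrite -quotientMl ?defG.
    rewrite mul_subG //; rewrite centsC.
      apply: (@subset_trans _ _ (C / 'C_G(U))); last exact: sub_der1_abelian.
      apply: subset_trans (quotientS _ (subsetIr _ _)) _.
      rewrite /= norm_joinEl // quotientMl // (quotientS1 sUC) mulg1; exact: subxx.
    apply: subset_trans (quotientS _ (subsetIl _ _)) _; exact: sub_der1_abelian.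
  have S1 : S / 'C_G(U) = 1.
    apply: (minnormal_pquot_trivial minU sUG pU _ pS).
    by rewrite /normal quotientS //= cents_norm.
  have : S \subset 'C_G(U) by rewrite -quotient_sub1 // S1.
  by rewrite subsetI => /andP[].
have nB := mp_TI_norm mpG nsU tiB (central A B mpG cA' cB' tiA cD).
rewrite setIC in cD.
have nA := mp_TI_norm (mp_sym mpG) nsU tiA (central B A (mp_sym mpG) cB' cA' tiB cD).
have [defG _ _] := mpG.
rewrite subsetI der_sub cyclic_der1_cent //.
apply: (minnormal_norm_cyclic minU) => X sXU.
by rewrite -defG mul_subG ?nA ?nB.
Qed.

Lemma coset_p'elt (gT : finGroupType) (A C : {group gT}) (p : nat) h :
  A \subset 'N(C) -> h \in A / C -> p^'.-elt h ->
  exists a, [/\ a \in A, p^'.-elt a & coset C a = h].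
Proof.
move=> nCA /morphimP[a nCa Aa ->] p'h; exists a.`_p^'; split.
- by rewrite groupX.
- exact: p_elt_constt.
by rewrite morph_constt // (constt_p_elt p'h).
Qed.

(* The p'-elements of A centralise A :&: U and normalise B :&: U, and conversely
   for B, so they commute modulo C = 'C_G(U).  Hence A / C :&: B / C, which is
   central and so a p'-group, is trivial, and the p'-part X of A / C is normal
   in G / C.  As X has nonzero fixed points on U, it is trivial. *)
Lemma mp_abelian_quotient_pgroup (gT : finGroupType) (G A B U : {group gT}) (p : nat) :
  mp G A B -> minnormal U G -> U \subset G -> p.-group U ->
  A^`(1) \subset 'C_G(U) -> B^`(1) \subset 'C_G(U) ->
  (exists n, rcomm (A :&: U) A n = 1) -> (exists n, rcomm (B :&: U) B n = 1) ->
  A :&: U != 1 -> (A :&: U) * (B :&: U) = U ->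
  p.-group (A / 'C_G(U)).
Proof.
move=> mpG minU sUG pU cA' cB' [m rA] [n rB] ntW defU.
have [ntU nUG min] := minnormalP _ _ minU; have nsU : U <| G by rewrite /normal sUG.
have nsC := cent_minnormal_normal nUG; have nCG := normal_norm nsC.
have [defG pA pB] := mpG; have sAG := mp_subl mpG; have sBG := mp_subr mpG.
have nCA := subset_trans sAG nCG; have nCB := subset_trans sBG nCG.
have nUA := subset_trans sAG nUG; have nUB := subset_trans sBG nUG.
have irr (Z : {group coset_of 'C_G(U)}) : Z <| G / 'C_G(U) -> p.-group Z -> Z :=: 1.
  exact: minnormal_pquot_trivial minU sUG pU.
have centp' (D : {group gT}) k a : D \subset 'N(U) -> rcomm (D :&: U) D k = 1 ->
    a \in D -> p^'.-elt a -> a \in 'C(D :&: U).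
  move=> nUD rD Da p'a; rewrite -cycle_subG.
  have nW : <[a]> \subset 'N(D :&: U).
    by rewrite cycle_subG; apply: (subsetP (normsI (normG D) nUD)).
  have pW : p.-group (D :&: U) := pgroupS (subsetIr _ _) pU.
  apply: (@coprime_rcomm _ (D :&: U)%G <[a]>%G k) => //.
  - exact: pnat_coprime pW p'a.
  - exact: nilpotent_sol (pgroup_nil pW).
  by apply/trivgP; rewrite /= -rD rcomm_sub ?cycle_subG.
have centU g : g \in 'C(A :&: U) -> g \in 'C(B :&: U) -> g \in 'C(U).
  by move=> gA gB; rewrite -defU centM inE gA.
have cosetI g h : g \in G -> h \in G -> coset 'C_G(U) g = coset 'C_G(U) h ->
    exists2 c, c \in 'C(U) & g = c * h.
  move=> Gg Gh /rcoset_kercosetP.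
  move=> /(_ (subsetP nCG g Gg) (subsetP nCG h Gh)) /rcosetP[c /setIP[_ cc] ->].
  by exists c.
have cUS (S : {set gT}) c : S \subset U -> c \in 'C(U) -> c \in 'C(S).
  by move=> sSU; apply: subsetP; apply: centS.
set Ab := (A / 'C_G(U))%G; set Bb := (B / 'C_G(U))%G; set H := (G / 'C_G(U))%G.
have mpH : mp H Ab Bb := mp_quotient nCG mpG.
have [defH _ _] := mpH; have sAbH := mp_subl mpH; have sBbH := mp_subr mpH.
have cAb : abelian Ab by apply: sub_der1_abelian.
have cBb : abelian Bb by apply: sub_der1_abelian.
have tiAB : Ab :&: Bb = 1.
  have cI : H \subset 'C(Ab :&: Bb).
    rewrite -defH mul_subG // centsC; first by rewrite subIset // [Ab \subset _]cAb.
    by rewrite subIset // [Bb \subset _]cBb orbT.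
  have nsI : (Ab :&: Bb)%G <| H by rewrite /normal subIset ?sAbH //= cents_norm.
  have nilI : nilpotent (Ab :&: Bb) by apply: abelian_nil; apply: abelianS cAb; apply: subsetIl.
  have p1 : 'O_p(Ab :&: Bb) = 1.
    by apply: irr; [apply: char_normal_trans nsI; apply: pcore_char | apply: pcore_pgroup].
  have p'I : p^'.-group (Ab :&: Bb).
    have := nilpotent_pcoreC p nilI; rewrite p1 dprod1g => <-; exact: pcore_pgroup.
  apply/trivgP/subsetP=> h Ih; have p'h := mem_p_elt p'I Ih; have [Ah Bh] := setIP Ih.
  have [a [Aa p'a ea]] := coset_p'elt nCA Ah p'h.
  have [b [Bb0 p'b eb]] := coset_p'elt nCB Bh p'h.
  have [c cc eab] := cosetI a b (subsetP sAG a Aa) (subsetP sBG b Bb0) (etrans ea (esym eb)).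
  have ca : a \in 'C(U).
    apply: centU; first exact: centp' nUA rA Aa p'a.
    rewrite eab; apply: groupM; first exact: cUS (subsetIr _ _) cc.
    exact: centp' nUB rB Bb0 p'b.
  by rewrite -ea inE coset_id // inE (subsetP sAG).
(* H' is abelian by Ito's theorem, and its p-part, a normal p-subgroup of [H], is trivial. *)
have H'p' : p^'.-group H^`(1).
  have cH' := abelian_mul_der1_abelian defH cAb cBb.
  have p1 : 'O_p(H^`(1)) = 1.
    apply: irr; last exact: pcore_pgroup.
    exact: gFnormal_trans (der_normal _ _).
  have := nilpotent_pcoreC p (abelian_nil cH'); rewrite p1 dprod1g => <-.
  exact: pcore_pgroup.
pose X := 'O_p^'(Ab)%G; pose Y := 'O_p(Bb)%G; pose Y' := 'O_p^'(Bb)%G.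
have sXA : X \subset Ab := pcore_sub _ _.
have p'X : p^'.-group X := pcore_pgroup _ _.
have defB : Y * Y' = Bb by apply: dprodW; apply: nilpotent_pcoreC; apply: abelian_nil.
have nXY' : Y' \subset 'C(X).
  apply/centsP=> y Yy x Xx.
  have [a [Aa p'a <-]] := coset_p'elt nCA (subsetP sXA x Xx) (mem_p_elt p'X Xx).
  have [b [Bb0 p'b <-]] := coset_p'elt nCB (subsetP (pcore_sub _ _) y Yy) (mem_p_elt (pcore_pgroup _ _) Yy).
  have Ga := subsetP sAG a Aa; have Gb := subsetP sBG b Bb0.
  have nCa := subsetP nCG a Ga; have nCb := subsetP nCG b Gb.
  rewrite /commute -!morphM //; apply/rcoset_kercosetP; rewrite ?groupM //.
  apply/rcosetP; exists [~ b^-1, a^-1]; last first.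
    by rewrite commgEl conjgE !invgK !mulgA mulgKV mulgKV.
  rewrite inE groupR ?groupV //=; apply: centU.
    have cW : a \in 'C(A :&: U) by apply: centp' nUA rA Aa p'a.
    have -> : [~ b^-1, a^-1] = (a ^ b^-1) * a^-1 by rewrite commgEr invgK.
    apply: groupM; last by rewrite groupV.
    rewrite memJ_norm // groupV.
    have := mp_p'elt_norm (mp_sym mpG) nsU pU Bb0 p'b.
    by apply/subsetP/norms_cent/subxx.
  have cV : b \in 'C(B :&: U) by apply: centp' nUB rB Bb0 p'b.
  have -> : [~ b^-1, a^-1] = b * (b^-1 ^ a^-1) by rewrite commgEl invgK.
  apply: groupM => //; rewrite memJ_norm ?groupV //.
  have := mp_p'elt_norm mpG nsU pU Aa p'a.
  by apply/subsetP/norms_cent/subxx.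
(* [X] is a Hall p'-subgroup of the group [X * Y], so it absorbs the derived subgroup, a normal
   p'-subgroup, and is therefore normal. *)
have nXY : Y \subset 'N(X).
  have cXY : X * Y = Y * X := mp_TI_permute mpH tiAB sXA (pcore_sub _ _).
  have [L defL] := comm_group_setM cXY.
  have sXL : X \subset L by rewrite defL mulG_subl.
  have sYL : Y \subset L by rewrite defL mulG_subr.
  have sLH : L \subset H by rewrite defL mul_subG // (subset_trans (pcore_sub _ _)).
  have p'L' : p^'.-group L^`(1) by apply: pgroupS H'p'; apply: dergS.
  have hallX : p^'.-Hall(L) X.
    rewrite /pHall sXL p'X /= pnatNK defL indexMg.
    by apply: pnat_dvd (dvdn_indexg _ _) _; apply: pcore_pgroup.
  have nL'X : X \subset 'N(L^`(1)) by apply: subset_trans sXL (der_norm _ _).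
  have eX : L^`(1) <*> X = X.
    apply: (sub_pHall hallX); rewrite ?joing_subr //.
      by rewrite /= norm_joinEr // pgroupM p'L'.
    by rewrite join_subG der_sub.
  apply: subset_trans sYL _; apply: normal_norm; apply: sub_der1_normal => //.
  by rewrite -eX joing_subl.
have nsX : X <| H.
  rewrite /normal (subset_trans sXA) //= -defH mul_subG //.
    exact: normal_norm (pcore_normal _ _).
  by rewrite -defB mul_subG // cents_norm.
pose L := (coset 'C_G(U) @*^-1 X)%G.
have nsL : L <| G.
  by rewrite /L -[X in _ <| X](quotientGK nsC) cosetpre_normal.
have cWL : A :&: U \subset 'C(L).
  rewrite centsC; apply/subsetP=> g Lg; have Gg := subsetP (normal_sub nsL) g Lg.
  have Xg : coset 'C_G(U) g \in X by case/morphpreP: Lg.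
  have [a [Aa p'a ea]] := coset_p'elt nCA (subsetP sXA _ Xg) (mem_p_elt p'X Xg).
  have [c cc ->] := cosetI g a Gg (subsetP sAG a Aa) (esym ea).
  apply: groupM; first exact: cUS (subsetIr _ _) cc.
  exact: centp' nUA rA Aa p'a.
have eU : 'C_U(L) = U.
  apply: (min 'C_U(L)%G) => /=; rewrite ?subsetIl //.
    by apply: subG1_contra ntW; rewrite subsetI subsetIr.
  by rewrite normsI // norms_cent // normal_norm.
have X1 : X :=: 1.
  have cUL : U \subset 'C(L) by apply/setIidPl.
  by rewrite -(cosetpreK X) quotientS1 // subsetI (normal_sub nsL) centsC.
have := nilpotent_pcoreC p (abelian_nil cAb).
rewrite -/X X1 dprodg1 => eA; rewrite -[A / _]eA; exact: pcore_pgroup.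
Qed.

(** For X inside [U], the group [B * X] meets [U] in X, so [B] normalises every such X. The nonzero
    fixed points of [A] on [U] thus form a normal subgroup of [G], so [A] centralises [U]; all
    subgroups of [U] are normal in [G] and [U] is cyclic. *)
Lemma mp_sub_TI_inner (gT : finGroupType) (G A B U : {group gT}) :
  mp G A B -> quasinilpotent A -> minnormal U G -> abelian U ->
  U \subset A -> B :&: U = 1 -> G^`(1) \subset 'C_G(U).
Proof.
move=> mpG qnA minU cUU sUA tiB; have [ntU nUG min] := minnormalP _ _ minU.
have [defG _ _] := mpG; have sAG := mp_subl mpG; have sBG := mp_subr mpG.
have nUA := subset_trans sAG nUG; have nUB := subset_trans sBG nUG.
have nsUA : U <| A by rewrite /normal sUA.
have nBX (X : {group gT}) : X \subset U -> B \subset 'N(X).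
  move=> sXU; have [L defL] := mp_joinl mpG (subset_trans sXU sUA).
  have sBL : B \subset L by rewrite defL mulG_subl.
  have <- : L :&: U = X by rewrite defL setIC -group_modr // setIC tiB mul1g.
  by rewrite normsI // normsG.
have [n rA] := qn_abelian_normal qnA nsUA cUU.
have cUA : A \subset 'C(U).
  rewrite centsC -(min 'C_U(A)%G) ?subsetIr ?subsetIl //=.
    exact: nilact_cent_nontrivial rA.
  rewrite -defG mul_subG ?nBX ?subsetIl //.
  by rewrite normsI ?norms_cent ?normG.
rewrite subsetI der_sub cyclic_der1_cent //.
apply: (minnormal_norm_cyclic minU) => X sXU.
by rewrite -defG mul_subG ?nBX // cents_norm // (subset_trans cUA) ?centS.
Qed.

Lemma mp_inner (gT : finGroupType) (G A B U : {group gT}) :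
  mp G A B -> quasinilpotent A -> quasinilpotent B ->
  minnormal U G -> U \subset G -> G^`(1) \subset U * 'C_G(U).
Proof.
move=> mpG qnA qnB minU sUG.
have [cUU|nabU] := boolP (abelian U); last exact: mp_inner_nonabelian mpG _ _ _ _ _.
have [ntU nUG min] := minnormalP _ _ minU.
have [defG _ _] := mpG; have sAG := mp_subl mpG; have sBG := mp_subr mpG.
have nUA := subset_trans sAG nUG; have nUB := subset_trans sBG nUG.
have sUC : U \subset 'C_G(U) by rewrite subsetI sUG.
rewrite (mulSGid sUC).
have /is_abelemP[p prp /abelem_pgroup pU] :=
  charsimple_solvable (minnormal_charsimple minU) (abelian_sol cUU).
have [snA' snD] := mp_subnormal mpG; have [snB' _] := mp_subnormal (mp_sym mpG).
have cA' : A^`(1) \subset 'C_G(U).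
  by rewrite -(mulSGid sUC) (qn_subnormal_inner qnA (der_normal 1 A)).
have cB' : B^`(1) \subset 'C_G(U).
  by rewrite -(mulSGid sUC) (qn_subnormal_inner qnB (der_normal 1 B)).
have [[tiA tiB] | defU] := mp_minnormal_cap mpG minU sUG.
  apply: (mp_TI_inner mpG minU sUG pU) => //.
  apply: (subnormal_TI_cent minU sUG snD) => /=.
  by apply/trivgP; rewrite /= -tiA setIC setSI // subsetIl.
have [W1|ntW] := eqVneq (A :&: U) 1.
  apply: (mp_sub_TI_inner (mp_sym mpG)) => //.
  by rewrite -defU W1 mul1g subsetIl.
have [V1|ntV] := eqVneq (B :&: U) 1.
  apply: (mp_sub_TI_inner mpG) => //.
  by rewrite -defU V1 mulg1 subsetIl.
have nilC (C : {group gT}) : quasinilpotent C -> C \subset G ->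
    exists n, rcomm (C :&: U) C n = 1.
  move=> qnC sCG; apply: qn_abelian_normal => //; last first.
    exact: abelianS (subsetIr _ _) cUU.
  by rewrite /normal subsetIl normsI ?normG // (subset_trans sCG).
have pA := mp_abelian_quotient_pgroup mpG minU sUG pU cA' cB' (nilC A qnA sAG)
  (nilC B qnB sBG) ntW defU.
have defU' : (B :&: U) * (A :&: U) = U.
  by rewrite -{3}defU; apply/esym/comm_group_setP; rewrite defU groupP.
have pB := mp_abelian_quotient_pgroup (mp_sym mpG) minU sUG pU cB' cA'
  (nilC B qnB sBG) (nilC A qnA sAG) ntV defU'.
have nsC := cent_minnormal_normal nUG; have nCG := normal_norm nsC.
(* When both factors meet [U] nontrivially, the quotient by ['C_G(U)] is a p-group acting faithfully
   and irreducibly on a p-group, hence trivial. *)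
have pG : p.-group (G / 'C_G(U)).
  have -> : G / 'C_G(U) = (A / 'C_G(U)) * (B / 'C_G(U)).
    by rewrite -quotientMl ?defG // (subset_trans sAG).
  by rewrite pgroupM pA.
have G1 := minnormal_pquot_trivial minU sUG pU (normal_refl (G / 'C_G(U))) pG.
apply: subset_trans (der_sub _ _) _.
by rewrite -quotient_sub1 // G1.
Qed.

(** * The quasinilpotent residual *)

Lemma sub_mul_centsecP (gT : finGroupType) (G M N U : {group gT}) :
  N <| G -> U <| G -> M \subset G ->
  reflect (forall g, g \in M -> exists u c,
             [/\ u \in U, c \in G, [~: U, <[c]>] \subset N & g = u * c])
    (M \subset U * 'C_G(U / N | 'Q)).
Proof.
move=> nsN nsU sMG; have sUG := normal_sub nsU.
apply: (iffP subsetP) => inM g Mg.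
  case/imset2P: (inM g Mg) => u c Uu Cc ->; exists u, c.
  have Gc : c \in G by case/setIP: Cc.
  by split=> //; rewrite -(mem_centsecQ nsN sUG).
have [u [c [Uu Gc cc ->]]] := inM g Mg.
by rewrite mem_mulg // mem_centsecQ.
Qed.

(** Quasinilpotence of H / N expressed inside [H], so that different [N] can be compared without
    changing the ambient type. *)
Definition inner_above (gT : finGroupType) (H N : {group gT}) : Prop :=
  forall V U : {group gT}, chief_factor H V U -> N \subset V ->
    H \subset U * 'C_H(U / V | 'Q).

(** [Z] is not assumed to lie in [H]: in the application [H] is a factor of the product and [Z] a
    term of the series of the whole group. *)
Lemma inner_above_qn (gT : finGroupType) (H Z : {group gT}) :
  H \subset 'N(Z) -> inner_above H (H :&: Z) -> quasinilpotent (H / Z)%G.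
Proof.
move=> nZH inH; apply/quasinilpotentP=> Vb Ub /chief_factorP[nsV nsU ltVU max].
pose pre (X : {group coset_of Z}) := (H :&: coset Z @*^-1 X)%G.
have preq (X : {group coset_of Z}) : X <| H / Z -> pre X / Z = X.
  move=> nsX; rewrite /= quotientIG ?sub_cosetpre // cosetpreK.
  exact/setIidPr/normal_sub.
have prens (X : {group coset_of Z}) : X <| H / Z -> pre X <| H.
  move=> nsX; rewrite /normal subsetIl normsI ?normG //.
  apply: subset_trans (morphpre_norm _ _); rewrite -sub_quotient_pre //.
  exact: normal_norm.
have sHZ X : H :&: Z \subset pre X by rewrite setIS // sub_cosetpre.
have preK (W : {group gT}) : W \subset H -> H :&: Z \subset W -> pre (W / Z)%G = W :> {set gT}.
  move=> sWH sHZW; rewrite /= quotientK ?(subset_trans sWH) //.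
  by rewrite -group_modr // mulSGid.
have chVU : chief_factor H (pre Vb) (pre Ub).
  apply/chief_factorP; split; rewrite ?prens //.
    rewrite properE; apply/andP; split.
      by rewrite setIS // morphpreS // proper_sub.
    apply: contra (proper_subn ltVU) => /(quotientS Z).
    by rewrite !preq.
  move=> W nsW sVW ltWU; have sWH := normal_sub nsW.
  have sHZW : H :&: Z \subset W := subset_trans (sHZ Vb) sVW.
  rewrite -(preK W) // [X in pre X](_ : _ = Vb) //; apply/val_inj.
  apply: (max (W / Z)%G) => /=.
  - exact: quotient_normal.
  - by rewrite -(preq Vb) // quotientS.
  rewrite properE -{1}(preq Ub) // quotientS ?(proper_sub ltWU) //=.
  apply: contra (proper_subn ltWU) => sUW.
  by rewrite -(preK W) // setIS // morphpreS.
have sUH := normal_sub (prens Ub nsU).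
apply/sub_mul_centsecP=> // _ /morphimP[g nZg Hg ->].
have /subsetP/(_ g Hg) := inH _ _ chVU (sHZ Vb).
case/imset2P=> u c Uu Cc eg; have Hc : c \in H by case/setIP: Cc.
have nZU := subset_trans sUH nZH; have nZc := subsetP nZH c Hc.
exists (coset Z u), (coset Z c); split.
- by rewrite -(preq Ub) // mem_quotient.
- exact: mem_quotient.
- rewrite -quotient_cycle // -(preq Ub) // -(preq Vb) // -quotientR ?cycle_subG //.
  by rewrite quotientS // -(mem_centsecQ (prens Vb nsV) sUH Hc).
by rewrite eg morphM // (subsetP nZU).
Qed.

Lemma qn_inner_above (gT : finGroupType) (H N : {group gT}) :
  N <| H -> quasinilpotent (H / N)%G -> inner_above H N.
Proof.
move=> nsN /quasinilpotentP inH V U chVU sNV.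
have [nsV nsU ltVU max] := chief_factorP _ _ _ chVU.
have nNH := normal_norm nsN; have sUH := normal_sub nsU; have sVH := normal_sub nsV.
have nNU := subset_trans sUH nNH; have nNV := subset_trans sVH nNH.
have sNU := subset_trans sNV (proper_sub ltVU).
have chb : chief_factor (H / N) (V / N) (U / N).
  apply/chief_factorP; split; rewrite ?quotient_normal //.
    by rewrite properE quotientS ?(proper_sub ltVU) //= quotientSGK // proper_subn.
  move=> X nsX sVX ltXU; rewrite /=; suff <- : coset N @*^-1 X = V by rewrite cosetpreK.
  apply: (max (coset N @*^-1 X)%G) => /=.
  - by rewrite -[X in _ <| X](quotientGK nsN) cosetpre_normal.
  - by rewrite -sub_quotient_pre.
  rewrite -(quotientGK (normalS sNU sUH nsN)) cosetpre_proper.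
  exact: ltXU.
have nsVb : (V / N)%G <| H / N := quotient_normal _ nsV.
have nsUb : (U / N)%G <| H / N := quotient_normal _ nsU.
apply/sub_mul_centsecP=> // h Hh.
have /(sub_mul_centsecP nsVb nsUb (subxx _)) inb := inH _ _ chb.
have [u [c [/morphimP[x nNx Ux eu] Hc cc eh]]] := inb _ (mem_quotient N Hh).
exists x, (x^-1 * h); have Hx := subsetP sUH x Ux.
have Hg : x^-1 * h \in H by rewrite groupM ?groupV.
have nNg := subsetP nNH _ Hg.
split=> //; last by rewrite mulKVg.
rewrite -(quotientSGK _ sNV); last first.
  by rewrite (subset_trans _ nNU) // commg_subl cycle_subG (subsetP (normal_norm nsU)).
rewrite quotientR ?cycle_subG // quotient_cycle //.
have -> // : coset N (x^-1 * h) = c.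
by apply: (mulgI u); rewrite -eh eu -morphM // mulKVg.
Qed.

Lemma chief_factor_persp (gT : finGroupType) (G X Y : {group gT}) :
  X <| G -> Y <| G ->
  chief_factor G (X :&: Y) X -> chief_factor G Y (X <*> Y).
Proof.
move=> nsX nsY /chief_factorP[_ _ ltX max].
have nXY : X \subset 'N(Y) := subset_trans (normal_sub nsX) (normal_norm nsY).
apply/chief_factorP; split; rewrite ?normalY //.
  rewrite properE joing_subr join_subG subxx andbT /=.
  by apply: contra (proper_subn ltX) => sXY; rewrite subsetI subxx.
move=> Z nsZ sYZ ltZ.
have defZ : Y * (X :&: Z) = Z.
  rewrite group_modl // -norm_joinEr // joingC; apply/setIidPr; exact: proper_sub.
suff eZ : X :&: Z = X :&: Y by rewrite -defZ eZ mulGSid ?subsetIr.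
apply: (max (X :&: Z)%G); rewrite ?normalI ?setIS //=.
rewrite properE subsetIl subsetI subxx /=.
apply: contra (proper_subn ltZ) => sXZ; by rewrite join_subG sXZ.
Qed.

Lemma chief_factor_persp_down (gT : finGroupType) (G X Y : {group gT}) :
  X <| G -> Y <| G ->
  chief_factor G Y (X <*> Y) -> chief_factor G (X :&: Y) X.
Proof.
move=> nsX nsY /chief_factorP[_ _ ltX max].
have nXY : X \subset 'N(Y) := subset_trans (normal_sub nsX) (normal_norm nsY).
apply/chief_factorP; split; rewrite ?normalI //.
  rewrite properE subsetIl subsetI subxx /=.
  by apply: contra (proper_subn ltX) => sXY; rewrite join_subG sXY subxx.
move=> Z nsZ sYZ ltZ; have sZX := proper_sub ltZ.
apply/eqP; rewrite eqEsubset sYZ andbT subsetI sZX /=.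
suff <- : Z <*> Y = Y by apply: joing_subl.
apply: (max (Z <*> Y)%G); rewrite ?joing_subr ?normalY //=.
rewrite properE join_subG joing_subr andbT (subset_trans sZX) ?joing_subl //=.
apply: contra (proper_subn ltZ); rewrite join_subG => /andP[sXZY _].
have -> : X = (X :&: (Z <*> Y))%G by apply/val_inj/esym/setIidPl.
rewrite /= norm_joinEl ?(subset_trans sZX) // setIC -group_modl //.
by rewrite mul_subG // setIC.
Qed.

Lemma inner_persp (gT : finGroupType) (G X Y J I : {group gT}) :
  X <| G -> Y <| G -> J = X <*> Y :> {set gT} -> I = X :&: Y :> {set gT} ->
  J * 'C_G(J / Y | 'Q) = X * 'C_G(X / I | 'Q).
Proof.
move=> nsX nsY eJ eI; have sXG := normal_sub nsX; have sYG := normal_sub nsY.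
have nXY : X \subset 'N(Y) := subset_trans sXG (normal_norm nsY).
have nsI : I <| G by rewrite eI normalI.
have -> : 'C_G(X / I | 'Q) = 'C_G(X / Y | 'Q).
  apply/setP=> c; have [Gc|nGc] := boolP (c \in G); last by rewrite !inE (negbTE nGc).
  rewrite !mem_centsecQ // eI subsetI commg_subl cycle_subG.
  by rewrite (subsetP (normal_norm nsX)).
rewrite eJ quotientYidr // norm_joinEl // -mulgA mulSGid //.
by rewrite sub_centsecQ // commg_subr.
Qed.

(** A chief factor U / V that [N1] does not cover is perspective to one above [N1]. Otherwise it is
    perspective to the factor of [U :&: N1] by [V :&: N1], and this one to a factor above [N2],
    because [N1 :&: N2] lies in [V]. *)
Lemma inner_aboveI (gT : finGroupType) (H N1 N2 : {group gT}) :
  N1 <| H -> N2 <| H -> inner_above H N1 -> inner_above H N2 ->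
  inner_above H (N1 :&: N2).
Proof.
move=> ns1 ns2 in1 in2 V U chVU sIV; have [nsV nsU ltVU max] := chief_factorP _ _ _ chVU.
have sVU := proper_sub ltVU.
have nVN1 : N1 \subset 'N(V) := subset_trans (normal_sub ns1) (normal_norm nsV).
have nsVN : V <*> N1 <| H by rewrite normalY.
have nsUI : U :&: N1 <| H by rewrite normalI.
have [sUVN | nsub] := boolP (U \subset V <*> N1); last first.
  have eV : U :&: (V <*> N1) = V.
    apply: (max (U :&: (V <*> N1))%G); rewrite ?normalI //=.
      by rewrite subsetI sVU joing_subl.
    by rewrite properE subsetIl subsetI subxx.
  have ch1 : chief_factor H (V <*> N1) (U <*> (V <*> N1)).
    by apply: chief_factor_persp => //; rewrite eV.
  have := in1 _ _ ch1 (joing_subr _ _).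
  by rewrite (inner_persp nsU nsVN (erefl _) (esym eV)).
have defU : V * (U :&: N1) = U.
  by rewrite setIC group_modl // -norm_joinEr //; apply/setIidPr.
have eU : (U :&: N1) <*> V = U.
  rewrite joingC norm_joinEr // subIset // orbC nVN1 //.
have eI : (U :&: N1) :&: V = V :&: N1.
  by rewrite setIAC (setIidPr sVU).
have chI : chief_factor H ((U :&: N1) :&: V) (U :&: N1).
  apply: chief_factor_persp_down => //.
  by rewrite /= eU.
have nsVI : V :&: N1 <| H by rewrite normalI.
pose Y := ((V :&: N1) <*> N2)%G.
have nsY : Y <| H by rewrite /Y /= normalY.
have eY : (U :&: N1) :&: Y = (U :&: N1) :&: V.
  rewrite eI /= norm_joinEl; last first.
    exact: subset_trans (normal_sub nsVI) (normal_norm ns2).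
  rewrite setIC -group_modl ?setSI //.
  rewrite mulGSid //; apply/subsetP=> x /setIP[N2x /setIP[Ux N1x]].
  by rewrite inE N1x andbT (subsetP sIV) // inE N1x.
have chY : chief_factor H Y ((U :&: N1) <*> Y).
  by apply: chief_factor_persp => //=; rewrite eY.
have := in2 _ _ chY (joing_subr _ _).
rewrite (inner_persp (I := (U :&: N1 :&: V)%G) nsUI nsY (erefl _) (esym eY)).
by rewrite -(inner_persp nsUI nsV (esym eU) (erefl _)).
Qed.

Lemma qn_residual_spec (gT : finGroupType) (H : {group gT}) :
  exists K : {group gT}, [/\ K = qn_residual H :> {set gT}, K <| H,
    K \subset H^`(1) & quasinilpotent (H / K)%G].
Proof.
have qnab : quasinilpotent (H / H^`(1))%G.
  apply/quasinilpotentP=> V U /chief_factorP[nsV nsU _ _].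
  apply: subset_trans (mulG_subr _ _); rewrite sub_centsecQ ?(normal_sub nsU) //.
  have cHH : abelian (H / H^`(1)) by apply: sub_der1_abelian.
  have /commG1P-> : U \subset 'C(H / H^`(1)) := subset_trans (normal_sub nsU) cHH.
  exact: sub1G.
(* An empty intersection is the full set rather than [H], so the invariant carried through the big
   intersection speaks of [H :&: S]. *)
pose P (S : {set gT}) := exists K : {group gT},
  [/\ K = H :&: S :> {set gT}, K <| H & inner_above H K].
have [K [eK nsK inK]] : P (qn_residual H).
  rewrite /qn_residual; elim/big_ind: _ => [|S T [K [eK nsK inK]] [L [eL nsL inL]] | N /andP[nsN qnN]].
  - exists H; split=> //; first by rewrite setIT.
    move=> V U /chief_factorP[_ nsU ltVU _] sHV.
    by have := proper_sub_trans ltVU (normal_sub nsU); rewrite properE sHV andbF.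
  - exists (K :&: L)%G; split; [|exact: normalI|exact: inner_aboveI].
    by rewrite /= eK eL setIACA setIid.
  exists N; split=> //; first by apply/esym/setIidPr/normal_sub.
  exact: qn_inner_above.
have sR : qn_residual H \subset H^`(1).
  by apply: (bigcap_inf H^`(1)%G); rewrite der_normal.
exists K; split=> //.
- by rewrite eK; apply/setIidPr; apply: subset_trans sR (der_sub _ _).
- by apply: subset_trans sR; rewrite eK subsetIr.
apply: inner_above_qn; first exact: normal_norm.
by rewrite (_ : (H :&: K)%G = K) //; apply/val_inj/setIidPr/normal_sub.
Qed.

(** * The series of a functorial *)

Lemma functorial_group_set gamma (Hf : functorial gamma) (gT : finGroupType)
    (G : {group gT}) : group_set (gamma gT G).
Proof. by case: Hf. Qed.

Definition gamma_group gamma (Hf : functorial gamma) (gT : finGroupType)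
    (G : {group gT}) : {group gT} := Group (functorial_group_set Hf G).

Lemma gamma_char gamma (Hf : functorial gamma) (gT : finGroupType) (G : {group gT}) :
  gamma_group Hf G \char G.
Proof. by have [_ h _] := Hf; apply: h. Qed.

Lemma gamma_series_group_char gamma (Hf : functorial gamma) n (gT : finGroupType)
    (G : {group gT}) :
  {K : {group gT} | K = gamma_series gamma n G :> {set gT} & K \char G}.
Proof.
elim: n => [|n [K eK chK]]; first by exists 1%G; rewrite ?char1.
have nsK := char_normal chK.
pose L := (coset K @*^-1 gamma_group Hf (G / K))%G.
exists L; first by rewrite /= /GFunctor.modulo -eK.
apply: (char_from_quotient (H := K)) => //.
  by rewrite normal_cosetpre.
by rewrite /= cosetpreK gamma_char.
Qed.

Definition gamma_series_group gamma (Hf : functorial gamma) n (gT : finGroupType)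
    (G : {group gT}) : {group gT} := s2val (gamma_series_group_char Hf n G).

Lemma gamma_series_groupE gamma (Hf : functorial gamma) n (gT : finGroupType)
    (G : {group gT}) : gamma_series_group Hf n G = gamma_series gamma n G :> {set gT}.
Proof. exact: (s2valP (gamma_series_group_char Hf n G)). Qed.

Lemma gamma_series_char gamma (Hf : functorial gamma) n (gT : finGroupType)
    (G : {group gT}) : gamma_series_group Hf n G \char G.
Proof. exact: (s2valP' (gamma_series_group_char Hf n G)). Qed.

Lemma gamma_series0 gamma (Hf : functorial gamma) (gT : finGroupType)
    (G : {group gT}) : gamma_series_group Hf 0 G = 1 :> {set gT}.
Proof. by rewrite gamma_series_groupE. Qed.

Lemma gamma_seriesS gamma (Hf : functorial gamma) n (gT : finGroupType)
    (G : {group gT}) :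
  gamma_series_group Hf n.+1 G =
  coset (gamma_series_group Hf n G) @*^-1
    gamma_group Hf (G / gamma_series_group Hf n G) :> {set gT}.
Proof.
by rewrite gamma_series_groupE /= /GFunctor.modulo -gamma_series_groupE.
Qed.

(** Since [N :&: Y] lies in [Z], the identity of [N] induces an epimorphism from [N / Y] to [N / Z],
    to which (F1) applies. *)
Lemma gamma_quotient_transfer gamma (gT : finGroupType) (N Y Z : {group gT}) x :
  cond_F1 gamma -> N \subset 'N(Y) -> N \subset 'N(Z) -> N :&: Y \subset Z ->
  x \in N -> coset Y x \in gamma _ (N / Y) -> coset Z x \in gamma _ (N / Z).
Proof.
move=> F1 nYN nZN sNYZ Nx gx.
pose q := restrm_morphism nYN (coset_morphism Y).
pose f := restrm_morphism nZN (coset_morphism Z).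
have kerqf : 'ker q \subset 'ker f.
  by rewrite !ker_restrm !ker_coset subsetI subsetIl.
have qN : q @* N = N / Y by rewrite morphim_restrm setIid.
have fN : f @* N = N / Z by rewrite morphim_restrm setIid.
rewrite -qN in gx; rewrite -fN.
have := F1 _ _ (q @* N)%G (factm_morphism kerqf (subxx N)).
rewrite /= morphim_factm => /subsetP; apply.
have <- : factm kerqf (subxx N) (q x) = coset Z x by rewrite factmE.
by apply: mem_morphim => //=; rewrite mem_morphim.
Qed.

Lemma gamma_series_normal gamma (Hf : functorial gamma) n (gT : finGroupType)
    (N G : {group gT}) :
  cond_F1 gamma -> cond_F2 gamma -> N <| G ->
  gamma_series_group Hf n N \subset gamma_series_group Hf n G.
Proof.
move=> F1 F2 nsN; elim: n => [|n IH]; first by rewrite gamma_series0 sub1G.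
have [sNG nNG] := andP nsN.
set Y := gamma_series_group Hf n N in IH *; set Z := gamma_series_group Hf n G in IH *.
have nYN : N \subset 'N(Y) by apply: char_norm (gamma_series_char _ _ _).
have nZG : G \subset 'N(Z) by apply: char_norm (gamma_series_char _ _ _).
have nZN := subset_trans sNG nZG.
rewrite !gamma_seriesS -/Y -/Z; apply/subsetP=> x /morphpreP[nYx gx].
have Nx : x \in N.
  have := char_sub (gamma_series_char Hf n.+1 N); rewrite gamma_seriesS -/Y => /subsetP.
  by apply; apply/morphpreP.
apply/morphpreP; split; first exact: (subsetP nZN).
have gx' : coset Z x \in gamma _ (N / Z).
  by apply: gamma_quotient_transfer gx => //; rewrite subIset // IH orbT.
have nsq : (N / Z)%G <| (G / Z)%G := quotient_normal _ nsN.
exact: (subsetP (F2 _ _ _ nsq)).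
Qed.

(** Here (F5) is used in the quotient of [G], and the induction hypothesis then lets (F1) carry the
    element from [N / Z] to [N / Y], the direction opposite to the previous lemma. *)
Lemma gamma_series_normalI gamma (Hf : functorial gamma) n (gT : finGroupType)
    (N G : {group gT}) :
  cond_F1 gamma -> cond_F5 gamma -> N <| G ->
  gamma_series_group Hf n G :&: N \subset gamma_series_group Hf n N.
Proof.
move=> F1 F5 nsN; elim: n => [|n IH]; first by rewrite !gamma_series0 subsetIl.
have [sNG nNG] := andP nsN.
set Y := gamma_series_group Hf n N in IH *; set Z := gamma_series_group Hf n G in IH *.
have nYN : N \subset 'N(Y) by apply: char_norm (gamma_series_char _ _ _).
have nZG : G \subset 'N(Z) by apply: char_norm (gamma_series_char _ _ _).
have nZN := subset_trans sNG nZG.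
rewrite !gamma_seriesS -/Y -/Z; apply/subsetP=> x /setIP[/morphpreP[nZx gx] Nx].
apply/morphpreP; split; first exact: (subsetP nYN).
have nsq : (N / Z)%G <| (G / Z)%G := quotient_normal _ nsN.
apply: (gamma_quotient_transfer F1 nZN nYN) => //; first by rewrite setIC.
by apply: (subsetP (F5 _ _ _ nsq)); rewrite inE gx mem_quotient.
Qed.

Lemma subnormal_chain_ind (gT : finGroupType) (P : {group gT} -> {group gT} -> Prop) :
  (forall G, P G G) ->
  (forall S N G : {group gT}, N <| G -> P S N -> P S G) ->
  forall S G : {group gT}, S <|<| G -> P S G.
Proof.
move=> Pid Pstep S G; have [n] := ubnP #|G|; elim: n G => // n IH G ltn.
case/subnormalEr=> [/val_inj-> // | [N [snSN nsNG ltN]]].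
apply: (Pstep _ N) => //; apply: IH snSN.
exact: leq_trans (proper_card ltN) _.
Qed.

Lemma gamma_series_subnormal gamma (Hf : functorial gamma) n (gT : finGroupType)
    (S G : {group gT}) :
  cond_F1 gamma -> cond_F2 gamma -> S <|<| G ->
  gamma_series_group Hf n S \subset gamma_series_group Hf n G.
Proof.
move=> F1 F2; apply: (subnormal_chain_ind (P := fun S G =>
  gamma_series_group Hf n S \subset gamma_series_group Hf n G)) => // {}S N {}G nsN sSN.
exact: subset_trans sSN (gamma_series_normal Hf n F1 F2 nsN).
Qed.

Lemma gamma_series_subnormalI gamma (Hf : functorial gamma) n (gT : finGroupType)
    (S G : {group gT}) :
  cond_F1 gamma -> cond_F5 gamma -> S <|<| G ->
  gamma_series_group Hf n G = G :> {set gT} -> gamma_series_group Hf n S = S :> {set gT}.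
Proof.
move=> F1 F5; apply: (subnormal_chain_ind (P := fun S G =>
  gamma_series_group Hf n G = G :> {set gT} ->
  gamma_series_group Hf n S = S :> {set gT})) => // {}S N {}G nsN PSN eG.
apply: PSN; apply/eqP; rewrite eqEsubset (char_sub (gamma_series_char _ _ _)) /=.
have := gamma_series_normalI Hf n F1 F5 nsN.
by rewrite eG (setIidPr (normal_sub nsN)).
Qed.

Lemma gamma_subnormal gamma (gT : finGroupType) (S G : {group gT}) :
  cond_F2 gamma -> S <|<| G -> gamma gT S \subset gamma gT G.
Proof.
move=> F2; apply: (subnormal_chain_ind (P := fun S G : {group gT} =>
  gamma gT S \subset gamma gT G)) => // {}S N {}G nsN sSN.
exact: subset_trans sSN (F2 _ _ _ nsN).
Qed.

Lemma gamma_abelian gamma (gT : finGroupType) (G : {group gT}) :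
  functorial gamma -> cond_F3 gamma -> abelian G -> gamma gT G = G.
Proof.
move=> Hf F3 cGG; have sgG := char_sub (gamma_char Hf G).
apply/eqP; rewrite eqEsubset sgG; apply: subset_trans (F3 _ G).
by rewrite subsetI subxx (subset_trans cGG) // centS.
Qed.

(** Each cyclic subgroup of [K] is subnormal in [G] and, being abelian, coincides with its own gamma
    by (F3). *)
Lemma nilpotent_normal_gamma gamma (gT : finGroupType) (K G : {group gT}) :
  functorial gamma -> cond_F2 gamma -> cond_F3 gamma ->
  K <| G -> nilpotent K -> K \subset gamma gT G.
Proof.
move=> Hf F2 F3 nsK nilK; apply/subsetP=> x Kx.
have snx : <[x]> <|<| G.
  apply: subnormal_trans (normal_subnormal nsK).
  by apply: nilpotent_subnormal; rewrite ?cycle_subG.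
apply: (subsetP (gamma_subnormal F2 snx)).
by rewrite gamma_abelian ?cycle_abelian ?cycle_id.
Qed.

Lemma mp_der1_gamma gamma (gT : finGroupType) (G A B : {group gT}) :
  functorial gamma -> cond_F2 gamma -> cond_F3 gamma ->
  mp G A B -> quasinilpotent A -> quasinilpotent B ->
  G^`(1) \subset gamma gT G.
Proof.
move=> Hf F2 F3 mpG qnA qnB; pose T := gamma_group Hf G.
have nsT : T <| G := char_normal (gamma_char Hf G).
have nsG' : G^`(1) <| G := der_normal 1 G.
have nsT1 : (T :&: G^`(1))%G <| G by rewrite normalI.
(* Modulo [N] the chief factor becomes a minimal normal subgroup of a mutually permutable product of
   quasinilpotent groups, where [mp_inner] applies. *)
have inG : acts_inner G G^`(1).
  move=> N U chNU; have [nsN nsU _ _] := chief_factorP _ _ _ chNU.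
  have nNG := normal_norm nsN.
  have minU := chief_factor_minnormal chNU.
  have qnq (C : {group gT}) : C \subset G -> quasinilpotent C -> quasinilpotent (C / N)%G.
    move=> sCG /quasinilpotentP qnC; apply: inner_above_qn.
      exact: subset_trans sCG nNG.
    by move=> V W chVW _; apply: qnC.
  have inq := mp_inner (U := (U / N)%G) (mp_quotient nNG mpG)
    (qnq A (mp_subl mpG) qnA) (qnq B (mp_subr mpG) qnB) minU
    (quotientS N (normal_sub nsU)).
  apply/sub_mul_centsecP=> //; first exact: normal_sub.
  move=> g G'g; have Gg := subsetP (normal_sub nsG') g G'g.
  have : coset N g \in (G / N)^`(1).
    by rewrite -quotient_der // mem_quotient.
  move/(subsetP inq) => /imset2P[_ c /morphimP[u nNu Uu ->] /setIP[Gc cc] eg].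
  have Gu := subsetP (normal_sub nsU) u Uu.
  have Gh : u^-1 * g \in G by rewrite groupM ?groupV.
  have sNU : N \subset U by case/chief_factorP: chNU => _ _ /proper_sub.
  exists u, (u^-1 * g); split=> //; last by rewrite mulKVg.
  have nNU := subset_trans (normal_sub nsU) nNG.
  have nNh : <[u^-1 * g]> \subset 'N(N) by rewrite cycle_subG (subsetP nNG).
  rewrite -quotient_cents2 // quotient_cycle ?(subsetP nNG) // centsC cycle_subG.
  suff -> : coset N (u^-1 * g) = c by [].
  by apply: (mulgI (coset N u)); rewrite -eg -morphM ?mulKVg // (subsetP nNG).
have [K [n [nsK sKG' defG' rK]]] := acts_inner_split inG nsG' nsT1 (subsetIr _ _).
have sKG := normal_sub nsK.
have nTK := subset_trans sKG (normal_norm nsT).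
(* [K] lies in G', so the extra commutator brings [T] into its intersection with G', on which [K]
   acts nilpotently in [n] steps. *)
have rTK : rcomm T K (1 + n) = 1.
  suff : rcomm T K (1 + n) \subset rcomm (T :&: G^`(1)) K n by rewrite rK => /trivgP.
  rewrite rcommD; apply: rcomm_sub => //=.
  change ([~: T, K] \subset T :&: G^`(1)).
  by rewrite subsetI commg_subl nTK commgSS ?(normal_sub nsT).
have nilK := nilact_nilpotent nsT nsK (F3 _ G) rTK.
have sKT := nilpotent_normal_gamma Hf F2 F3 nsK nilK.
have : (T :&: G^`(1))%G * K \subset T by rewrite mul_subG ?subsetIl.
by rewrite defG'.
Qed.

(** * The height and the two inequalities *)

Lemma gamma_series_leS gamma (Hf : functorial gamma) n (gT : finGroupType)
    (G : {group gT}) :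
  gamma_series_group Hf n G \subset gamma_series_group Hf n.+1 G.
Proof. by rewrite gamma_seriesS sub_cosetpre. Qed.

Lemma gamma_series_eqS gamma (Hf : functorial gamma) n (gT : finGroupType)
    (G : {group gT}) :
  gamma_series_group Hf n G = G :> {set gT} ->
  gamma_series_group Hf n.+1 G = G :> {set gT}.
Proof.
move=> eG; apply/eqP; rewrite eqEsubset (char_sub (gamma_series_char _ _ _)) /=.
by rewrite -{1}eG gamma_series_leS.
Qed.

Lemma gamma_series_eq_le gamma (Hf : functorial gamma) m n (gT : finGroupType)
    (G : {group gT}) :
  (m <= n)%N -> gamma_series_group Hf m G = G :> {set gT} ->
  gamma_series_group Hf n G = G :> {set gT}.
Proof.
move/subnKC <-; elim: (n - m)%N => [|k IH] eG; first by rewrite addn0.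
by rewrite addnS; apply/gamma_series_eqS/IH.
Qed.

(** If a term Z equals the next one, gamma of G / Z is trivial, and (F3) makes its centraliser, all
    of G / Z, trivial too. So the order grows at each step before [G]. *)
Lemma gamma_series_card gamma (Hf : functorial gamma) (gT : finGroupType)
    (G : {group gT}) : cond_F3 gamma -> gamma_series_group Hf #|G| G = G :> {set gT}.
Proof.
move=> F3.
have step n : gamma_series_group Hf n G = G :> {set gT} \/
              (n < #|gamma_series_group Hf n G|)%N.
  elim: n => [|n [eG|ltn]]; first by right; rewrite cardG_gt0.
    by left; apply: gamma_series_eqS.
  have [eG|neG] := eqVneq (gamma_series_group Hf n G : {set gT}) G.
    by left; apply: gamma_series_eqS.
  right; apply: leq_trans (proper_card (_ : gamma_series_group Hf n G \proper _)) => //.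
  rewrite properE gamma_series_leS /=; set Z := gamma_series_group Hf n G in ltn neG *.
  have chZ : Z \char G := gamma_series_char Hf n G.
  apply: contra neG; rewrite gamma_seriesS -/Z => sZ.
  have g1 : gamma _ (G / Z) = 1.
    have : gamma_group Hf (G / Z) \subset [1 (coset_of Z)].
      rewrite -(cosetpreK (gamma_group Hf (G / Z))).
      by apply: subset_trans (quotientS Z sZ) _; rewrite trivg_quotient.
    by move/trivgP.
  have := F3 _ (G / Z)%G; rewrite /= g1 cent1T setIT => sGZ.
  rewrite eqEsubset (char_sub chZ) /=.
  by rewrite -quotient_sub1 ?(normal_norm (char_normal chZ)).
case: (step #|G|) => // ltG.
have := subset_leq_card (char_sub (gamma_series_char Hf #|G| G)).
by rewrite leqNgt ltG.
Qed.

Lemma h_gamma_series gamma (Hf : functorial gamma) (gT : finGroupType)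
    (G : {group gT}) : cond_F3 gamma ->
  gamma_series_group Hf (h_gamma gamma G) G = G :> {set gT}.
Proof.
move=> F3; rewrite gamma_series_groupE /h_gamma.
(* [find] would return the length of the list on failure; the index [#|G|] is a success, so the
   value found is genuine. *)
set a := fun n => _; have ha : has a (iota 0 #|G|.+1).
  apply/hasP; exists #|G|; first by rewrite mem_iota /= ltnS.
  by rewrite /a -(gamma_series_groupE Hf) gamma_series_card.
have := nth_find 0%N ha; rewrite nth_iota ?add0n; first by move/eqP.
by rewrite -[X in (_ < X)%N](size_iota 0) -has_find.
Qed.

Lemma h_gamma_le gamma (Hf : functorial gamma) n (gT : finGroupType) (G : {group gT}) :
  gamma_series_group Hf n G = G :> {set gT} -> (h_gamma gamma G <= n)%N.
Proof.
move=> eG; rewrite leqNgt; apply/negP=> lt.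
have ltn : (n < #|G|.+1)%N.
  by apply: leq_trans lt _; rewrite -[X in (_ <= X)%N](size_iota 0) find_size.
have := before_find 0%N lt; rewrite nth_iota // add0n.
by rewrite -(gamma_series_groupE Hf) eG eqxx.
Qed.

Theorem theorem9 (gamma : GFunctor.object_map) (gT : finGroupType)
    (G A B : {group gT}) :
  functorial gamma -> cond_F1 gamma -> cond_F2 gamma -> cond_F3 gamma ->
  mutually_permutable G A B ->
  (h_gamma gamma G <=
     maxn (h_gamma gamma (qn_residual A)) (h_gamma gamma (qn_residual B)) + 2)%N
  /\
  (cond_F5 gamma ->
   (maxn (h_gamma gamma (qn_residual A)) (h_gamma gamma (qn_residual B))
      <= h_gamma gamma G)%N).
Proof.
move=> Hf F1 F2 F3 mpG.
have sub (C E : {group gT}) : mp G C E -> exists K : {group gT},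
    [/\ K = qn_residual C :> {set gT}, K <| C, K <|<| G & quasinilpotent (C / K)%G].
  move=> mpC; have [K [eK nsK sKC' qnK]] := qn_residual_spec C.
  exists K; split=> //; have [snC' _] := mp_subnormal mpC.
  apply: subnormal_trans snC'; apply: normal_subnormal.
  exact: normalS sKC' (der_sub _ _) nsK.
have [K [eK nsK snK qnK]] := sub A B mpG.
have [L [eL nsL snL qnL]] := sub B A (mp_sym mpG).
rewrite -eK -eL; split=> [|F5]; last first.
  have le (S : {group gT}) : S <|<| G -> (h_gamma gamma S <= h_gamma gamma G)%N.
    move=> snS; apply: (h_gamma_le (Hf := Hf)).
    by apply: gamma_series_subnormalI snS _ => //; apply: h_gamma_series.
  by rewrite geq_max !le.
set h := maxn _ _; pose Z := gamma_series_group Hf h G.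
have subZ (S : {group gT}) : S <|<| G -> (h_gamma gamma S <= h)%N -> S \subset Z.
  move=> snS leh; apply: subset_trans (gamma_series_subnormal Hf h F1 F2 snS).
  by rewrite (gamma_series_eq_le leh) // h_gamma_series.
have sKZ : K \subset Z by apply: subZ; rewrite ?leq_maxl.
have sLZ : L \subset Z by apply: subZ; rewrite ?leq_maxr.
have nsZ : Z <| G := char_normal (gamma_series_char Hf h G).
have nZG := normal_norm nsZ.
have qnq (C S : {group gT}) : C \subset G -> S <| C -> S \subset Z ->
    quasinilpotent (C / S)%G -> quasinilpotent (C / Z)%G.
  move=> sCG nsS sSZ qnS; apply: inner_above_qn; first exact: subset_trans sCG nZG.
  move=> V U chVU sV; apply: (qn_inner_above nsS qnS chVU).
  by apply: subset_trans sV; rewrite subsetI normal_sub.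
have sG' := mp_der1_gamma Hf F2 F3 (mp_quotient nZG mpG)
  (qnq A K (mp_subl mpG) nsK sKZ qnK) (qnq B L (mp_subr mpG) nsL sLZ qnL).
apply: (h_gamma_le (Hf := Hf)); rewrite addn2.
pose Z1 := gamma_series_group Hf h.+1 G.
have nsZ1 : Z1 <| G := char_normal (gamma_series_char Hf h.+1 G).
have sG'Z1 : G^`(1) \subset Z1.
  rewrite gamma_seriesS -sub_quotient_pre ?(subset_trans (der_sub _ _)) //.
  by rewrite quotient_der.
(* The step from h to h + 1 absorbs the derived subgroup; the quotient left is abelian, hence its
   own gamma by (F3), which accounts for the second step. *)
have cGZ1 : abelian (G / Z1) by apply: sub_der1_abelian.
rewrite gamma_seriesS -/Z1 /= (gamma_abelian (G := (G / Z1)%G)) //.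
exact: quotientGK.
Qed.
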